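(* Let $p\in\mathbb{R}$ and for real $z>0$ put $$\sigma=\frac{1}{p+\ln z},\qquad \tau=\frac{p+\ln(p+\ln z)}{p+\ln z}.$$ The domain of convergence, in real $z$, of the (transformed) series $$\sum_{n=1}^\infty \sum_{m=1}^n (-1)^{n-m}\genfrac{[}{]}{0pt}{}{n}{n-m+1}\frac{\sigma^{n-m}\tau^{m}}{m!}$$ is defined by $$\operatorname{Re} W_{-1}\left(-e^{p-1}(p+\ln z)\right)>p-1\quad\text{and}\quad z>e^{-p},$$ which is equivalent to $$z>z_p=\begin{cases}e^{1-2p}, & p\le 0,\\ e^{-p+\eta_0\csc\eta_0}, & p>0,\end{cases}$$ where $\eta_0\in(0,\pi)$ is the root of the equation $\eta_0\cot\eta_0=1-p$.
   Context: $\genfrac{[}{]}{0pt}{}{n}{k}$ is the (unsigned) Stirling cycle number: the number of permutations of $n$ elements with exactly $k$ cycles. The series is summed as an outer series over $n$ of the finite inner sums over $m$. The setting is the real one, $p+\ln z>0$, in which $\sigma$ and $\tau$ are real. ''Domain of convergence'' means the open region of such $z$ in which the series converges (the interior of the set of points of convergence). $W_{-1}$ is the branch $-1$ of the Lambert $W$ function (the multivalued inverse of $w\mapsto we^w$); for $-1/e\le x<0$, $W_{-1}(x)$ is the real solution $w\le -1$ of $we^w=x$, and for $x<-1/e$ it is the solution $w$ of $we^w=x$ with $-\pi<\operatorname{Im} w<0$. *)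

(* Defs.v *)
(* Real analysis in the Stdlib/Coquelicot setting; MathComp is used only for
   permutations and their cycles. *)
From Stdlib Require Import Reals ClassicalEpsilon.
From mathcomp Require Import all_boot perm.
From Coquelicot Require Import Coquelicot.

Set Implicit Arguments.
Unset Strict Implicit.
Unset Printing Implicit Defensive.

(* [porbits s] contains the fixed points of [s] as singleton cycles. *)
Definition stirling_cycle (n k : nat) : nat :=
  #|[set s : {perm 'I_n} | #|porbits s| == k]|.

Local Open Scope R_scope.

Definition sigma (p z : R) : R := 1 / (p + ln z).

Definition tau (p z : R) : R := (p + ln (p + ln z)) / (p + ln z).

Definition series_term (p z : R) (n : nat) : R :=
  sum_n_m (fun m : nat =>
    (-1) ^ (n - m) * INR (stirling_cycle n (n - m + 1)) *
    (sigma p z ^ (n - m) * tau p z ^ m / INR m`!)) 1 n.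

(* [ex_series] sums from index 0, hence the shift.  The guards keep to the
   range where the (total) functions [ln] and [/] have their usual meaning,
   so that [sigma] and [tau] are real. *)
Definition convergence_set (p z : R) : Prop :=
  0 < z /\ 0 < p + ln z /\ ex_series (fun n : nat => series_term p z n.+1).

(* The interior matters: at the isolated zero of [tau] all terms vanish. *)
Definition convergence_domain (p : R) : R -> Prop :=
  interior (convergence_set p).

Definition Cexp (w : C) : C :=
  (exp (Re w) * cos (Im w), exp (Re w) * sin (Im w)).

Definition is_LambertWm1 (x : R) (w : C) : Prop :=
  (w * Cexp w)%C = RtoC x /\
  ((- / exp 1 <= x < 0 /\ Im w = 0 /\ Re w <= -1) \/
   (x < - / exp 1 /\ - PI < Im w < 0)).

(* Branch -1 of the Lambert function on the negative real axis (the lower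
   edge of the cut beyond the branch point); unspecified for [0 <= x]. *)
Definition LambertWm1 (x : R) : C :=
  epsilon (inhabits (RtoC 0)) (is_LambertWm1 x).

Definition is_eta0 (p eta : R) : Prop :=
  0 < eta < PI /\ eta * (cos eta / sin eta) = 1 - p.

Definition eta0 (p : R) : R := epsilon (inhabits 0) (is_eta0 p).

Definition z_bound (p : R) : R :=
  if Rle_dec p 0 then exp (1 - 2 * p)
  else exp (- p + eta0 p * (1 / sin (eta0 p))).

(* Main.v *)
From mathcomp Require all_boot perm.
Require Import Defs.
From Stdlib Require Import Reals Ranalysis5 Factorial Lra Lia ClassicalEpsilon.
From Coquelicot Require Import Coquelicot.
Local Open Scope R_scope.

(** Put [l = p + ln z] and [q = p + ln l].  The term of index [n] of the series
    is [coef n q / l ^ n] with a polynomial [coef n] in [q]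
    ([series_term_coef]), so that the series is the power series
    [v (s) = sum of coef n q * s ^ n] at [s = 1 / l], and its radius of
    convergence depends on [q] alone.  The sum [v] inverts the map
    [inv_sum q v = (1 - exp (- v)) / (q - v)] near [0]: this is contained in
    the differential equation [v' (1 + s - s (q - v)) = q - v], a quadratic
    recurrence for the coefficients ([ode_coef_zero]), which comes from the
    recurrence of the cycle numbers ([stirling_cycle_SS]).  The singularities
    of [v] are critical values of [inv_sum q].  The critical points are
    [q - 1 - w] with [w e^w = - e^(q - 1) = - e^(p - 1) l], with critical values
    of modulus [e^(1 - q + Re w)]; branch [-1] of the Lambert function yields
    the nearest one, and comparison with [1 / l = e^(p - q)] gives the condition
    [Re w > p - 1].

    That the nearest critical value is the radius of convergence is proved
    without a theory of analytic functions.

    Divergence.  If the series converges at some [s0] beyond the critical value,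
    its partial sums satisfy the differential equation up to a defect that
    tends to 0 uniformly on a smaller disk ([Cpoly_ode],
    [ode_defect_bound_lim]).  Along a path of [v] from [0] to the critical point
    with [inv_sum q] inside this disk, the equation says that the partial sums
    at [inv_sum q v] tend to [v] ([continuation_segment]); at the critical point
    this contradicts the differential equation ([continuation_not_critical]).
    A segment is a suitable path for [q < 0], an L-shaped one for [q > 0]
    ([not_ex_series_q_neg], [not_ex_series_q_pos]).  For [q = 0] all
    coefficients vanish, which is harmless since only the interior of the set
    of convergence is considered.

    Convergence for [q <= 0].  The coefficients alternate in sign, and the
    differential equation becomes a differential inequality for the partial
    sums, which keeps them bounded ([ex_series_q_nonpos]).

    Convergence for [q > 0].  Here [coef n q] is the coefficient of [y ^ n] in
    [(1 - y) (2 - y) ... (n - 1 - y) exp (q y)].  Cauchy's estimate on the circle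
    through the saddle point suffices: the logarithm of the modulus is a concave
    function of the cosine of the argument, hence is maximal at the saddle
    ([coef_bound]), and its value there is a Riemann sum of an elementary
    integral ([ex_series_q_pos]).

    For [q > 0] the nearest critical points are [ln (y / sin y) + i y] and its
    conjugate, with [0 < y < PI] determined by [critical_q y = q], and the
    condition reads [1 - y cot y > p].  Since [critical_q] and [1 - y cot y]
    both increase, this is [y > eta0] when [p > 0], which gives the explicit
    bound ([lambert_condition_iff]). *)

(** * The recurrence of the cycle numbers *)

Section StirlingRecurrence.

Import all_boot perm.
Local Open Scope nat_scope.

(** Lifting adds the fixed point [ord0] and relabels the other cycles. *)
Lemma porbits_lift_perm (n : nat) (t : 'S_n) :
  #|porbits (lift_perm ord0 ord0 t)| = #|porbits t|.+1.
Proof.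
set L := lift_perm ord0 ord0 t.
have powL0 i : (L ^+ i)%g ord0 = ord0.
  elim: i => [|i IH]; first by rewrite expg0 perm1.
  by rewrite expgSr permM IH lift_perm_id.
have powL i x : (L ^+ i)%g (lift ord0 x) = lift ord0 ((t ^+ i)%g x).
  elim: i => [|i IH]; first by rewrite !expg0 !perm1.
  by rewrite !expgSr !permM IH lift_perm_lift.
have orb0 : porbit L ord0 = [set ord0].
  apply/setP=> y; rewrite inE; apply/porbitP/eqP => [[i ->] // | ->].
  by exists 0; rewrite expg0 perm1.
have orbl x : porbit L (lift ord0 x) = lift ord0 @: porbit t x.
  apply/setP=> y; apply/porbitP/imsetP => [[i ->] | [z /porbitP[i ->] ->]].
    by exists ((t ^+ i)%g x); rewrite ?powL ?mem_porbit.
  by exists i; rewrite powL.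
have -> : porbits L = [set ord0] |: ((fun A : {set 'I_n} => lift ord0 @: A) @: porbits t).
  apply/setP=> A; rewrite !inE; apply/imsetP/orP.
    move=> [x _ ->]; case: (unliftP ord0 x) => [y|] ->; last by left; rewrite orb0.
    by right; rewrite orbl; apply: imset_f; apply: imset_f.
  case=> [/eqP-> | /imsetP[B /imsetP[x _ ->] ->]].
    by exists ord0; rewrite ?orb0.
  by exists (lift ord0 x); rewrite ?orbl.
rewrite cardsU1 card_imset; last first.
  by apply: imset_inj; apply: lift_inj.
case: imsetP => [[B _ eqB] | _]; last by rewrite add1n.
have : ord0 \in lift ord0 @: B by rewrite -eqB set11.
by case/imsetP=> x _ /eqP; rewrite (negbTE (neq_lift _ _)).
Qed.

(** Every permutation of [n.+1] points is uniquely
    [tperm ord0 j * lift_perm ord0 ord0 t]: the transposition inserts [ord0] into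
    the cycle of [j], and [j = ord0] leaves it fixed. *)
Lemma stirling_cycle_rec (n k : nat) :
  stirling_cycle n.+1 k = n * stirling_cycle n k + (k != 0) * stirling_cycle n k.-1.
Proof.
pose L (t : 'S_n) := lift_perm ord0 ord0 t.
pose f (u : 'I_n.+1 * 'S_n) := (tperm ord0 u.1 * L u.2)%g.
have f_inj : injective f.
  move=> [i s] [j t] E.
  have fi u : f u u.1 = ord0 by rewrite /f permM tpermR lift_perm_id.
  have Eij : i = j.
    apply: (@perm_inj _ (f (i, s))); rewrite (fi (i, s)) E.
    by rewrite (fi (j, t)).
  move: E; rewrite {}Eij /f /= => /mulgI E.
  congr pair; apply/permP=> x; apply: (@lift_inj _ ord0).
  by rewrite -(lift_perm_lift ord0) -/(L s) E lift_perm_lift.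
have f_bij : bijective f.
  by apply: inj_card_bij f_inj _; rewrite card_prod !card_Sn card_ord factS.
have cf i t : #|porbits (f (i, t))| = #|porbits t| + (i == ord0).
  have := porbits_mul_tperm (L t) ord0 i; rewrite /= -/(f (i, t)) porbits_lift_perm.
  have -> : (ord0 \notin porbit (L t) i) = (ord0 != i).
    rewrite porbit_sym; congr (~~ _); apply/porbitP/eqP => [[m ->]|->].
      by elim: m => [|m IH]; rewrite ?expg0 ?perm1 // expgSr permM -IH lift_perm_id.
    by exists 0; rewrite expg0 perm1.
  rewrite [i == _]eq_sym; case: eqP => _ /=; first by rewrite !addn0 addn1.
  by rewrite addn0 addn1 -[1.*2]/(2) addn2 => -[].
have st m j : stirling_cycle m j = \sum_(s : 'S_m) (#|porbits s| == j).
  by rewrite /stirling_cycle -sum1dep_card big_mkcond; apply: eq_bigr => s _; case: eqP.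
rewrite !st (reindex f) /=; last exact: onW_bij.
rewrite -(pair_bigA _ (fun i t => nat_of_bool (#|porbits (f (i, t))| == k))) /=.
rewrite (bigD1 ord0) //= addnC; congr (_ + _).
  rewrite (eq_bigr (fun _ => \sum_(s : 'S_n) (#|porbits s| == k))).
    by rewrite sum_nat_const cardC1 card_ord.
  by move=> i /negbTE i0; apply: eq_bigr => t _; rewrite cf i0 addn0.
rewrite big_distrr /=; apply: eq_bigr => t _; rewrite cf eqxx addn1.
by case: k => [|k]; rewrite ?mul0n //= mul1n eqSS.
Qed.

Lemma stirling_cycle_0 (k : nat) : stirling_cycle 0 k = (k == 0).
Proof.
rewrite /stirling_cycle.
have c0 (s : 'S_0) : #|porbits s| = 0.
  by apply/eqP; rewrite cards_eq0; apply/eqP/setP=> A; rewrite inE; apply/imsetP=> -[[]].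
case: k => [|k]; last first.
  by apply/eqP; rewrite cards_eq0; apply/eqP/setP=> s; rewrite !inE c0.
by rewrite [RHS](_ : _ = factorial 0) // -card_Sn; apply: eq_card => s; rewrite !inE c0.
Qed.

Lemma stirling_cycle_00 : stirling_cycle 0 0 = 1.
Proof. by rewrite stirling_cycle_0. Qed.

Lemma stirling_cycle_0S (k : nat) : stirling_cycle 0 (S k) = O.
Proof. by rewrite stirling_cycle_0. Qed.

Lemma stirling_cycle_S0 (n : nat) : stirling_cycle (S n) 0 = O.
Proof. by elim: n => [|n IH]; rewrite stirling_cycle_rec ?IH ?muln0. Qed.

Lemma stirling_cycle_SS (n k : nat) :
  stirling_cycle (S n) (S k) =
  Nat.add (Nat.mul n (stirling_cycle n (S k))) (stirling_cycle n k).
Proof. by rewrite stirling_cycle_rec /= mul1n. Qed.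

Local Open Scope R_scope.

Lemma series_termE (p z : R) (n : nat) :
  series_term p z n =
  sum_n_m (fun m : nat =>
    ((-1) ^ (Nat.sub n m) * INR (stirling_cycle n (S (Nat.sub n m))) *
    (Defs.sigma p z ^ (Nat.sub n m) * tau p z ^ m / INR (fact m)))) 1 n.
Proof.
apply: sum_n_m_ext => m; rewrite addn1; congr (_ * (_ / INR _)).
by elim: m => // m IH; rewrite factS IH /= mulSn.
Qed.

End StirlingRecurrence.

Lemma stirling_cycle_gt (n k : nat) : (n < k)%nat -> stirling_cycle n k = O.
Proof.
revert k; induction n as [|n IH]; intros k Hk; destruct k as [|k]; try lia.
- apply stirling_cycle_0S.
- rewrite stirling_cycle_SS, (IH (S k)), (IH k) by lia; lia.
Qed.

(** * Finite sums *)

Lemma sum_last (f : nat -> R) (n : nat) :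
  sum_f_R0 f (S n) = sum_f_R0 f n + f (S n).
Proof. reflexivity. Qed.

Lemma sum_zero (f : nat -> R) : sum_f_R0 f O = f O.
Proof. reflexivity. Qed.

Lemma sum_first (f : nat -> R) (n : nat) :
  sum_f_R0 f (S n) = f O + sum_f_R0 (fun i => f (S i)) n.
Proof. rewrite decomp_sum by lia; reflexivity. Qed.

Lemma sum_rev (f : nat -> R) (n : nat) :
  sum_f_R0 f n = sum_f_R0 (fun i => f (n - i)%nat) n.
Proof.
induction n as [|n IH]; [reflexivity|].
rewrite (sum_first (fun i => f (S n - i)%nat)).
change (fun i => f (S n - S i)%nat) with (fun i => f (n - i)%nat).
rewrite <- IH, sum_last, Nat.sub_0_r; ring.
Qed.

Lemma sum_0 (n : nat) : sum_f_R0 (fun _ => 0) n = 0.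
Proof. induction n as [|n IH]; [reflexivity|]; rewrite sum_last, IH; ring. Qed.

Lemma sum_scal (c : R) (f : nat -> R) (n : nat) :
  sum_f_R0 (fun i => c * f i) n = c * sum_f_R0 f n.
Proof. induction n as [|n IH]; [reflexivity|]; rewrite !sum_last, IH; ring. Qed.

Lemma is_derive_Rmult (f g : R -> R) (x df dg : R) :
  is_derive f x df -> is_derive g x dg ->
  is_derive (fun y => f y * g y) x (df * g x + f x * dg).
Proof.
intros Hf Hg; apply (@is_derive_mult R_AbsRing f g); trivial; exact Rmult_comm.
Qed.

Lemma is_derive_Rplus (f g : R -> R) (x df dg : R) :
  is_derive f x df -> is_derive g x dg ->
  is_derive (fun y => f y + g y) x (df + dg).
Proof. exact (@is_derive_plus R_AbsRing R_NormedModule f g x df dg). Qed.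

Lemma is_derive_sum (f : nat -> R -> R) (d : nat -> R) (n : nat) (x : R) :
  (forall k, is_derive (f k) x (d k)) ->
  is_derive (fun y => sum_f_R0 (fun k => f k y) n) x (sum_f_R0 d n).
Proof.
intros H; induction n as [|n IH]; [apply H|].
apply is_derive_Rplus; [exact IH|apply H].
Qed.

(** * The coefficients of the transformed series *)

Definition divpow (k : nat) (q : R) : R := q ^ k / INR (fact k).

Definition divpow' (k : nat) (q : R) : R :=
  match k with O => 0 | S j => divpow j q end.

Lemma is_derive_divpow (k : nat) (q : R) :
  is_derive (divpow k) q (divpow' k q).
Proof.
unfold divpow; destruct k as [|k].
- simpl; auto_derive; trivial.
- unfold divpow', divpow.
  replace (q ^ k / INR (fact k)) with (/ INR (fact (S k)) * (INR (S k) * 1 * q ^ k)).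
  + apply (is_derive_ext (fun q => / INR (fact (S k)) * q ^ S k)); [intros t; apply Rmult_comm|].
    apply is_derive_scal, (is_derive_pow (fun q => q)); auto_derive; trivial.
  + rewrite fact_simpl, mult_INR; field.
    split; [apply INR_fact_neq_0|apply not_0_INR; lia].
Qed.

(** The terms of total degree [n] in [sigma] and [tau], divided by
    [sigma ^ n], with [tau / sigma = q].  The sum runs up to [i = n] so that
    [coef 0 = 0]. *)
Definition coef (n : nat) (q : R) : R :=
  sum_f_R0 (fun i => (-1) ^ i * INR (stirling_cycle n (S i)) * divpow (n - i) q) n.

Definition coef' (n : nat) (q : R) : R :=
  sum_f_R0 (fun i => (-1) ^ i * INR (stirling_cycle n (S i)) * divpow' (n - i) q) n.

Lemma is_derive_coef (n : nat) (q : R) : is_derive (coef n) q (coef' n q).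
Proof.
unfold coef, coef'; apply is_derive_sum; intros k.
apply is_derive_scal, is_derive_divpow.
Qed.

Lemma coef_0 (q : R) : coef 0 q = 0.
Proof. unfold coef; rewrite sum_zero, stirling_cycle_0S; simpl; ring. Qed.

Lemma coef'_0 (q : R) : coef' 0 q = 0.
Proof. unfold coef'; rewrite sum_zero, stirling_cycle_0S; simpl; ring. Qed.

Lemma coef_at_0 (n : nat) : coef n 0 = 0.
Proof.
unfold coef; transitivity (sum_f_R0 (fun _ => 0) n).
2: { rewrite sum_0; ring. }
apply sum_eq; intros i Hi.
destruct (Nat.eq_dec i n) as [->|Hne].
- rewrite stirling_cycle_gt by lia; simpl; ring.
- unfold divpow; rewrite pow_i by lia; unfold Rdiv; ring.
Qed.

Lemma coef'_shift (n : nat) (q : R) :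
  sum_f_R0 (fun i => (-1) ^ i * INR (stirling_cycle (S n) i) * divpow (S n - i) q) (S n)
  = - coef' (S n) q.
Proof.
unfold coef'; rewrite sum_first, sum_last.
rewrite stirling_cycle_S0, (stirling_cycle_gt (S n) (S (S n))) by lia.
rewrite (sum_eq _ (fun i => -1 * ((-1) ^ i * INR (stirling_cycle (S n) (S i)) * divpow' (S n - i) q))).
- rewrite sum_scal; simpl (INR 0); ring.
- intros i Hi; replace (S n - i)%nat with (S (S n - S i)) by lia.
  unfold divpow'; simpl pow; ring.
Qed.

(** The recurrence of the cycle numbers read on the coefficients.  For the
    generating function [v] it is the linear partial differential equation
    [(1 + s) d/dq v = s + s ^ 2 d/ds v]. *)
Lemma coef'_S (n : nat) (q : R) :
  coef' (S n) q =
  INR n * coef n q - coef' n q + match n with O => 1 | _ => 0 end.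
Proof.
destruct n as [|n].
- rewrite coef_0, coef'_0; unfold coef'; rewrite sum_last, sum_zero.
  rewrite !stirling_cycle_SS, !stirling_cycle_0S, stirling_cycle_00.
  simpl; unfold divpow; simpl; field.
- unfold Rminus; rewrite <- coef'_shift; unfold coef at 1; rewrite <- sum_scal.
  rewrite <- sum_plus, Rplus_0_r; unfold coef'; rewrite sum_last.
  rewrite (stirling_cycle_gt (S (S n)) (S (S (S n)))) by lia.
  rewrite Rmult_0_r, Rmult_0_l, Rplus_0_r; apply sum_eq; intros i Hi.
  rewrite stirling_cycle_SS, plus_INR, mult_INR.
  replace (S (S n) - i)%nat with (S (S n - i)) by lia; unfold divpow'; ring.
Qed.

Lemma series_term_coef (p z : R) (n : nat) : 0 < p + ln z ->
  series_term p z (S n) = coef (S n) (p + ln (p + ln z)) * (/ (p + ln z)) ^ S n.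
Proof.
intros Hl; rewrite series_termE; unfold Defs.sigma, tau.
set (q := p + ln (p + ln z)); set (l := p + ln z).
rewrite <- sum_n_m_S.
match goal with |- sum_n_m ?f 0 n = _ => change (sum_n f n = coef (S n) q * (/ l) ^ S n) end.
rewrite sum_n_Reals, sum_rev, Rmult_comm.
unfold coef; rewrite sum_last, (stirling_cycle_gt (S n) (S (S n))) by lia.
simpl (INR 0); rewrite Rmult_0_r, Rmult_0_l, Rplus_0_r, <- sum_scal.
apply sum_eq; intros i Hi.
replace (S n - S (n - i))%nat with i by lia.
replace (S n - i)%nat with (S (n - i)) by lia.
unfold divpow, Rdiv; rewrite Rmult_1_l, Rpow_mult_distr.
replace (S n) with (i + S (n - i))%nat at 2 by lia.
rewrite pow_add; ring.
Qed.

(** * The quadratic recurrence *)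

Definition conv (f g : nat -> R) (n : nat) : R :=
  sum_f_R0 (fun i => f i * g (n - i)%nat) n.

Lemma conv_comm (f g : nat -> R) (n : nat) : conv f g n = conv g f n.
Proof.
unfold conv; rewrite sum_rev; apply sum_eq; intros i Hi.
replace (n - (n - i))%nat with i by lia; ring.
Qed.

(** A product of degree [n] is homogeneous: by symmetry the index of either
    factor weighs [n / 2] on average. *)
Lemma conv_index (f : nat -> R) (n : nat) :
  conv (fun i => INR i * f i) f n = INR n / 2 * conv f f n.
Proof.
assert (H : conv (fun i => INR i * f i) f n + conv f (fun i => INR i * f i) n
            = INR n * conv f f n).
{ unfold conv; rewrite <- sum_plus, <- sum_scal; apply sum_eq; intros i Hi.
  rewrite minus_INR by trivial; ring. }
rewrite (conv_comm f) in H; lra.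
Qed.

Definition coef_sq (n : nat) (q : R) : R :=
  conv (fun i => coef i q) (fun i => coef i q) n.

Definition coef_sq' (n : nat) (q : R) : R :=
  2 * conv (fun i => coef' i q) (fun i => coef i q) n.

Lemma is_derive_coef_sq (n : nat) (q : R) :
  is_derive (coef_sq n) q (coef_sq' n q).
Proof.
replace (coef_sq' n q) with
  (sum_f_R0 (fun i => coef' i q * coef (n - i) q + coef i q * coef' (n - i) q) n).
- unfold coef_sq, conv; apply is_derive_sum; intros k.
  apply is_derive_Rmult; apply is_derive_coef.
- unfold coef_sq'; rewrite sum_plus.
  fold (conv (fun i => coef' i q) (fun i => coef i q) n).
  fold (conv (fun i => coef i q) (fun i => coef' i q) n).
  rewrite (conv_comm (fun i => coef i q)); ring.
Qed.

Lemma coef_sq'_S (n : nat) (q : R) :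
  coef_sq' (S n) q = INR n * coef_sq n q - coef_sq' n q + 2 * coef n q.
Proof.
unfold coef_sq', coef_sq.
assert (H : conv (fun i => coef' i q) (fun i => coef i q) (S n) =
  conv (fun i => INR i * coef i q) (fun i => coef i q) n
  - conv (fun i => coef' i q) (fun i => coef i q) n + coef n q).
2: { rewrite H, conv_index; field. }
unfold conv at 1; rewrite sum_first, coef'_0, Rmult_0_l, Rplus_0_l.
transitivity (conv (fun i => INR i * coef i q) (fun i => coef i q) n
  + -1 * conv (fun i => coef' i q) (fun i => coef i q) n +
  sum_f_R0 (fun i => match i with O => 1 | _ => 0 end * coef (n - i) q) n).
- unfold conv; rewrite <- sum_scal, <- !sum_plus; apply sum_eq; intros i Hi.
  rewrite coef'_S; simpl Nat.sub; ring.
- f_equal; [ring|].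
  destruct n as [|n]; [rewrite sum_zero; simpl; ring|].
  rewrite sum_first; rewrite Nat.sub_0_r, Rmult_1_l.
  transitivity (coef (S n) q + sum_f_R0 (fun _ => 0) n).
  + f_equal; apply sum_eq; intros i _; ring.
  + rewrite sum_0; ring.
Qed.

(** The coefficient of [s ^ n] in [v' (1 + s - s (q - v)) - (q - v)]. *)
Definition ode_coef (n : nat) (q : R) : R :=
  INR (S n) * coef (S n) q + (1 - q) * INR n * coef n q + coef n q
  + INR n / 2 * coef_sq n q - match n with O => q | _ => 0 end.

Lemma derive_zero_const (f : R -> R) :
  (forall x : R, is_derive f x 0) -> f 0 = 0 -> forall x, f x = 0.
Proof.
intros Hf H0 x; destruct (MVT_gen f 0 x (fun _ => 0)) as [c [_ Hc]].
- intros; apply Hf.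
- intros y _; apply derivable_continuous_pt; exists 0; apply is_derive_Reals, Hf.
- rewrite H0 in Hc; lra.
Qed.

(** This is the differential equation [v' (1 + s - s (q - v)) = q - v] for
    [v = sum of coef n q * s ^ n].  Like [v], its defect satisfies a linear
    partial differential equation, and it vanishes at [q = 0] where [v = 0]; so
    by induction on [n] its coefficients have zero derivative in [q]. *)
Lemma ode_coef_zero (n : nat) (q : R) : ode_coef n q = 0.
Proof.
destruct n as [|n].
{ unfold ode_coef, coef_sq, conv; rewrite sum_zero, coef_0.
  unfold coef; rewrite sum_last, sum_zero, !stirling_cycle_SS, !stirling_cycle_0S, stirling_cycle_00.
  simpl; unfold divpow; simpl; field. }
revert q; induction n as [|n IH]; intros q.
{ unfold ode_coef, coef_sq, conv; rewrite sum_last, sum_zero; simpl Nat.sub; rewrite coef_0.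
  unfold coef; rewrite !sum_last, !sum_zero.
  rewrite !stirling_cycle_SS, !stirling_cycle_0S, stirling_cycle_S0, stirling_cycle_00.
  simpl; unfold divpow; simpl; field. }
revert q; apply derive_zero_const.
2: { unfold ode_coef, coef_sq, conv; rewrite !coef_at_0.
  transitivity (INR (S (S n)) / 2 * sum_f_R0 (fun _ => 0) (S (S n))).
  - rewrite (sum_eq _ (fun _ => 0)); [rewrite sum_0; ring|].
    intros i _; rewrite coef_at_0; ring.
  - rewrite sum_0; ring. }
intros q.
set (m := S n) in *.
assert (Hd : forall k : nat, is_derive (ode_coef (S k)) q
  (INR (S (S k)) * coef' (S (S k)) q + (- INR (S k) * coef (S k) q + (1 - q) * INR (S k) * coef' (S k) q)
   + coef' (S k) q + INR (S k) / 2 * coef_sq' (S k) q)).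
{ intros k; unfold ode_coef.
  apply (is_derive_ext (fun q => (INR (S (S k)) * coef (S (S k)) q + (1 - q) * INR (S k) * coef (S k) q) + coef (S k) q
  + INR (S k) / 2 * coef_sq (S k) q)).
  { intros t; unfold ode_coef; simpl; symmetry; apply Rminus_0_r. }
  apply is_derive_Rplus; [apply is_derive_Rplus; [apply is_derive_Rplus|]|].
  - apply is_derive_scal, is_derive_coef.
  - apply (is_derive_Rmult (fun y => (1 - y) * INR (S k)) (coef (S k))); [|apply is_derive_coef].
    generalize (INR (S k)); intros c; auto_derive; trivial; ring.
  - apply is_derive_coef.
  - apply is_derive_scal, is_derive_coef_sq. }
(* [IH] holds for all [q], so the derivative of [ode_coef m] vanishes too. *)
assert (H0 := is_derive_unique _ _ _ (Hd n)).
fold m in H0; rewrite (Derive_ext _ (fun _ => 0) q IH), Derive_const in H0.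
specialize (IH q).
replace 0 with (INR (S (S m)) * coef' (S (S m)) q + (- INR (S m) * coef (S m) q + (1 - q) * INR (S m) * coef' (S m) q)
   + coef' (S m) q + INR (S m) / 2 * coef_sq' (S m) q); [apply Hd|].
rewrite (coef'_S (S m)), (coef_sq'_S m), !(coef'_S m).
rewrite (coef'_S m) in H0.
unfold ode_coef in IH.
change (match m with O => q | S _ => 0 end) with 0 in IH.
change (match m with O => 1 | S _ => 0 end) with 0 in *.
change (match S m with O => 1 | S _ => 0 end) with 0.
assert (Hm : 0 < INR m) by (apply lt_0_INR; unfold m; lia).
apply Rmult_eq_reg_l with (INR m); [|lra].
rewrite !S_INR in *.
(* The claim times [m] is [m + 1] times [m * IH - H0]. *)
match type of IH with ?u = _ => match type of H0 with _ = ?v =>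
  transitivity ((INR m + 1) * (INR m * u - v)); [|rewrite IH, <- H0; ring] end end.
field.
Qed.

(** * Truncated Cauchy products *)

Lemma sum_conv (f g : nat -> R) (n : nat) :
  sum_f_R0 (conv f g) n = sum_f_R0 (fun i => f i * sum_f_R0 g (n - i)) n.
Proof.
induction n as [|n IH]; [reflexivity|].
rewrite !sum_last, IH; unfold conv at 1; rewrite sum_last, Nat.sub_diag.
rewrite <- Rplus_assoc; f_equal; rewrite <- sum_plus; apply sum_eq; intros i Hi.
replace (S n - i)%nat with (S (n - i)) by lia; rewrite sum_last; ring.
Qed.

Lemma sum_nonneg (f : nat -> R) (n : nat) :
  (forall i, 0 <= f i) -> 0 <= sum_f_R0 f n.
Proof. intros Hf; apply cond_pos_sum, Hf. Qed.

Lemma sum_le_index (f : nat -> R) (m n : nat) :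
  (forall i, 0 <= f i) -> (m <= n)%nat -> sum_f_R0 f m <= sum_f_R0 f n.
Proof.
intros Hf Hmn; induction Hmn as [|n _ IH]; [lra|].
rewrite sum_last; specialize (Hf (S n)); lra.
Qed.

Lemma sum_conv_le (f g : nat -> R) (n : nat) :
  (forall i, 0 <= f i) -> (forall i, 0 <= g i) ->
  sum_f_R0 (conv f g) n <= sum_f_R0 f n * sum_f_R0 g n.
Proof.
intros Hf Hg; rewrite sum_conv, (Rmult_comm (sum_f_R0 f n)), <- sum_scal.
apply sum_Rle; intros i Hi; rewrite (Rmult_comm _ (f i)).
apply Rmult_le_compat_l; [apply Hf|apply sum_le_index; [exact Hg|lia]].
Qed.

Lemma conv_pow (f g : nat -> R) (x : R) (n : nat) :
  conv (fun i => f i * x ^ i) (fun i => g i * x ^ i) n = conv f g n * x ^ n.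
Proof.
unfold conv; rewrite (Rmult_comm _ (x ^ n)), <- sum_scal; apply sum_eq; intros i Hi.
replace n with (i + (n - i))%nat at 3 by lia; rewrite pow_add; ring.
Qed.

(** * Convergence for nonpositive [q] *)

(** The absolute value of [coef n (- r)] for [r >= 0]: all terms have the sign
    [(-1) ^ n]. *)
Definition abs_coef (r : R) (n : nat) : R := (-1) ^ n * coef n (- r).

Lemma sqr_sign (n : nat) : (-1) ^ n * (-1) ^ n = 1.
Proof. rewrite <- Rpow_mult_distr; replace (-1 * -1) with 1 by ring; apply pow1. Qed.

Lemma abs_coef_ge0 (r : R) (n : nat) : 0 <= r -> 0 <= abs_coef r n.
Proof.
intros Hr; unfold abs_coef, coef; rewrite <- sum_scal.
rewrite (sum_eq _ (fun i => INR (stirling_cycle n (S i)) * divpow (n - i) r)).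
- apply sum_nonneg; intros i; apply Rmult_le_pos; [apply pos_INR|].
  apply Rmult_le_pos; [apply pow_le, Hr|].
  left; apply Rinv_0_lt_compat, INR_fact_lt_0.
- intros i Hi; unfold divpow.
  replace (- r) with (-1 * r) by ring; rewrite Rpow_mult_distr.
  transitivity (((-1) ^ n * ((-1) ^ i * (-1) ^ (n - i))) * INR (stirling_cycle n (S i)) *
    (r ^ (n - i) / INR (fact (n - i)))); [unfold Rdiv; ring|].
  rewrite <- pow_add; replace (i + (n - i))%nat with n by lia; rewrite sqr_sign; ring.
Qed.

Lemma abs_coef_rec (r : R) (n : nat) :
  INR (S n) * abs_coef r (S n) =
  match n with O => r | _ => 0 end + (1 + r) * (INR n * abs_coef r n)
  + abs_coef r n + conv (fun i => INR i * abs_coef r i) (abs_coef r) n.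
Proof.
assert (H := ode_coef_zero n (- r)); unfold ode_coef, coef_sq in H.
rewrite <- conv_index in H.
assert (E : conv (fun i => INR i * abs_coef r i) (abs_coef r) n =
  (-1) ^ n * conv (fun i => INR i * coef i (- r)) (fun i => coef i (- r)) n).
{ unfold conv; rewrite <- sum_scal; apply sum_eq; intros i Hi; unfold abs_coef.
  replace n with (i + (n - i))%nat at 3 by lia; rewrite pow_add; ring. }
rewrite E; unfold abs_coef; simpl pow.
replace (INR (S n) * (-1 * (-1) ^ n * coef (S n) (- r))) with
  (- (-1) ^ n * (INR (S n) * coef (S n) (- r))) by ring.
replace (INR (S n) * coef (S n) (- r)) with
 (match n with O => - r | _ => 0 end - (1 - - r) * INR n * coef n (-r) - coef n (-r)
  - conv (fun i => INR i * coef i (- r)) (fun i => coef i (- r)) n) by lra.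
destruct n; simpl; ring.
Qed.

Definition poly (b : nat -> R) (N : nat) (x : R) : R :=
  sum_f_R0 (fun n => b n * x ^ n) N.

Definition poly' (b : nat -> R) (N : nat) (x : R) : R :=
  sum_f_R0 (fun n => b n * (INR n * x ^ pred n)) N.

Lemma is_derive_poly (b : nat -> R) (N : nat) (x : R) :
  is_derive (poly b N) x (poly' b N x).
Proof.
apply is_derive_sum; intros k; apply is_derive_scal.
replace (INR k * x ^ pred k) with (INR k * 1 * x ^ pred k) by ring.
apply (is_derive_pow (fun y => y)); auto_derive; trivial.
Qed.

Lemma poly_index (b : nat -> R) (N : nat) (x : R) :
  sum_f_R0 (fun n => (INR n * b n) * x ^ n) N = x * poly' b N x.
Proof.
unfold poly'; rewrite <- sum_scal; apply sum_eq; intros [|n] _; simpl; ring.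
Qed.

(** In the recurrence of the coefficients, truncation only drops nonnegative
    terms on the right, so that the differential equation of the full series
    becomes an inequality. *)
Lemma poly_abs_coef_ode (r x : R) (N : nat) : 0 <= r -> 0 <= x ->
  poly' (abs_coef r) N x * (1 - x * (1 + r) - x * poly (abs_coef r) N x)
  <= r + poly (abs_coef r) N x.
Proof.
intros Hr Hx; set (b := abs_coef r).
assert (Hb : forall n, 0 <= b n * x ^ n).
{ intros n; apply Rmult_le_pos; [apply abs_coef_ge0, Hr|apply pow_le, Hx]. }
assert (Hnb : forall n, 0 <= (INR n * b n) * x ^ n).
{ intros n; rewrite Rmult_assoc; apply Rmult_le_pos; [apply pos_INR|apply Hb]. }
cut (poly' b N x <= r + (1 + r) * (x * poly' b N x) + poly b N x
  + (x * poly' b N x) * poly b N x); [lra|].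
rewrite <- poly_index.
assert (HS := sum_nonneg _ N Hb); assert (HD := sum_nonneg _ N Hnb).
destruct N as [|N].
{ unfold poly'; simpl; unfold poly; simpl; specialize (Hb O); simpl in Hb.
  assert (Hb0 : b O = 0) by (unfold b, abs_coef; rewrite coef_0; ring).
  rewrite Hb0; lra. }
assert (E : poly' b (S N) x = r + (1 + r) * sum_f_R0 (fun n => (INR n * b n) * x ^ n) N
  + poly b N x + sum_f_R0 (conv (fun i => (INR i * b i) * x ^ i) (fun i => b i * x ^ i)) N).
{ unfold poly'; rewrite sum_first; simpl (INR 0); rewrite Rmult_0_l, Rmult_0_r, Rplus_0_l.
  transitivity (sum_f_R0 (fun n => (match n with O => r | _ => 0 end) * x ^ n
    + (1 + r) * ((INR n * b n) * x ^ n) + b n * x ^ n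
    + conv (fun i => (INR i * b i) * x ^ i) (fun i => b i * x ^ i) n) N).
  { apply sum_eq; intros n _; rewrite conv_pow, (Rmult_comm (b (S n))).
    simpl pred; rewrite Rmult_assoc, (Rmult_comm _ (b (S n))), <- Rmult_assoc.
    unfold b at 1; rewrite abs_coef_rec; fold b; ring. }
  rewrite !sum_plus, sum_scal; unfold poly; do 3 f_equal.
  clear; induction N as [|N IH]; [simpl; ring|rewrite sum_last, IH; ring]. }
rewrite E.
assert (H1 := sum_conv_le _ _ N Hnb Hb).
assert (H2 := sum_le_index _ N (S N) Hnb (Nat.le_succ_diag_r N)).
assert (H3 := sum_le_index _ N (S N) Hb (Nat.le_succ_diag_r N)).
assert (H4 := sum_nonneg _ N Hb); assert (H5 := sum_nonneg _ N Hnb).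
assert (H6 := Rmult_le_compat _ _ _ _ H5 H4 H2 H3).
unfold poly; nra.
Qed.

Lemma poly_abs_coef_0 (r : R) (N : nat) : poly (abs_coef r) N 0 = 0.
Proof.
unfold poly; rewrite (sum_eq _ (fun _ => 0)); [apply sum_0|].
intros [|n] _; [unfold abs_coef; rewrite coef_0|]; simpl; ring.
Qed.

(** For the full series [(1 - x (r + P)) e^P] is constant by the differential
    equation; for a partial sum it decreases from its value 1 at [x = 0]. *)
Lemma poly_abs_coef_subsolution (r x : R) (N : nat) : 0 <= r -> 0 <= x ->
  1 - exp (- poly (abs_coef r) N x) <= x * (r + poly (abs_coef r) N x).
Proof.
intros Hr Hx; set (P := poly (abs_coef r) N); set (P' := poly' (abs_coef r) N).
assert (Hd : forall y, is_derive (fun y => (1 - y * (r + P y)) * exp (P y)) y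
  ((- (r + P y) - y * P' y + (1 - y * (r + P y)) * P' y) * exp (P y))).
{ intros y; assert (HP := is_derive_poly (abs_coef r) N y); fold P P' in HP.
  auto_derive; [split; [|split]; trivial; exists (P' y); exact HP|].
  replace (Derive (fun x : R => P x) y) with (P' y) by (symmetry; exact (is_derive_unique P y _ HP)); ring. }
assert (H : (1 - x * (r + P x)) * exp (P x) <= 1).
{ destruct (MVT_gen (fun y => (1 - y * (r + P y)) * exp (P y)) 0 x
    (fun y => (- (r + P y) - y * P' y + (1 - y * (r + P y)) * P' y) * exp (P y)))
    as [c [Hc E]].
  - intros y _; apply Hd.
  - intros y _; apply derivable_continuous_pt; eexists; apply is_derive_Reals, Hd.
  - rewrite Rmin_left, Rmax_right in Hc by lra.
    unfold P in E at 3 4; rewrite poly_abs_coef_0, exp_0 in E; fold P in E.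
    assert (Ho := poly_abs_coef_ode r c N Hr (proj1 Hc)); fold P P' in Ho.
    assert (He := exp_pos (P c)).
    assert ((- (r + P c) - c * P' c + (1 - c * (r + P c)) * P' c) * exp (P c) * (x - 0) <= 0).
    { assert ((- (r + P c) - c * P' c + (1 - c * (r + P c)) * P' c) <= 0) by lra.
      assert (0 <= exp (P c) * x) by nra. nra. }
    lra. }
rewrite exp_Ropp; assert (He := exp_pos (P x)).
apply Rmult_le_reg_r with (exp (P x)); [trivial|].
rewrite Rmult_minus_distr_r, Rinv_l by lra; lra.
Qed.

(** The partial sums start from 0 and cannot cross a level [V] at which
    [poly_abs_coef_subsolution] fails. *)
Lemma poly_abs_coef_bound (r x V : R) (N : nat) : 0 <= r -> 0 <= x -> 0 < V ->
  x * (r + V) < 1 - exp (- V) -> poly (abs_coef r) N x < V.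
Proof.
intros Hr Hx HV H; apply Rnot_le_lt; intros Hc.
destruct (IVT_gen (poly (abs_coef r) N) 0 x V) as [y [Hy E]].
- intros y; apply derivable_continuous_pt; eexists; apply is_derive_Reals, is_derive_poly.
- rewrite poly_abs_coef_0, Rmin_left, Rmax_right by lra; lra.
- rewrite Rmin_left, Rmax_right in Hy by lra.
  assert (Hs := poly_abs_coef_subsolution r y N Hr (proj1 Hy)); rewrite E in Hs.
  assert (y * (r + V) <= x * (r + V)) by (apply Rmult_le_compat_r; lra); lra.
Qed.

(** The level [V = ln l] gives [poly_abs_coef_bound] at [x = / l] its widest
    range, since it minimizes [exp (- V) + V / l]. *)
Lemma ex_series_q_nonpos (p l : R) : 0 < l -> p + ln l <= 0 -> p <= 0 -> 1 - p < l ->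
  ex_series (fun n => coef n (p + ln l) * (/ l) ^ n).
Proof.
intros Hl Hq Hp Hpl; set (r := - (p + ln l)).
assert (Hil : 0 < / l) by (apply Rinv_0_lt_compat, Hl).
assert (Hln : 0 < ln l) by (rewrite <- ln_1; apply ln_increasing; lra).
apply ex_series_Rabs.
apply (ex_series_ext (fun n => abs_coef r n * (/ l) ^ n)).
{ intros n; replace (p + ln l) with (- r) by (unfold r; ring).
  rewrite <- (Rabs_pos_eq (abs_coef r n * _)).
  - unfold abs_coef; rewrite !Rabs_mult, pow_1_abs, Rmult_1_l; reflexivity.
  - apply Rmult_le_pos; [apply abs_coef_ge0; unfold r; lra|apply pow_le; lra]. }
apply ex_finite_lim_seq_incr with (M := ln l).
- intros n; rewrite !sum_n_Reals, sum_last.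
  assert (0 <= abs_coef r (S n) * (/ l) ^ S n); [|lra].
  apply Rmult_le_pos; [apply abs_coef_ge0; unfold r; lra|apply pow_le; lra].
- intros n; rewrite sum_n_Reals; left.
  apply (poly_abs_coef_bound r (/ l) (ln l) n); try (unfold r; lra).
  rewrite exp_Ropp, exp_ln by trivial; unfold r.
  apply Rmult_lt_reg_r with l; [trivial|].
  replace (/ l * (- (p + ln l) + ln l) * l) with (- p) by (field; lra).
  rewrite Rmult_minus_distr_r, Rinv_l; lra.
Qed.

(** * Complex sums *)

Fixpoint Csum (f : nat -> C) (n : nat) : C :=
  match n with O => f O | S m => (Csum f m + f (S m))%C end.

Lemma Csum_last (f : nat -> C) (n : nat) : Csum f (S n) = (Csum f n + f (S n))%C.
Proof. reflexivity. Qed.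

Lemma Csum_eq (f g : nat -> C) (n : nat) :
  (forall i, (i <= n)%nat -> f i = g i) -> Csum f n = Csum g n.
Proof.
induction n as [|n IH]; intros H; simpl; [apply H; lia|].
rewrite IH, H; [reflexivity|lia|intros i Hi; apply H; lia].
Qed.

Lemma Csum_plus (f g : nat -> C) (n : nat) :
  Csum (fun i => f i + g i)%C n = (Csum f n + Csum g n)%C.
Proof. induction n as [|n IH]; simpl; [|rewrite IH]; ring. Qed.

Lemma Csum_scal (c : C) (f : nat -> C) (n : nat) :
  Csum (fun i => c * f i)%C n = (c * Csum f n)%C.
Proof. induction n as [|n IH]; simpl; [|rewrite IH]; ring. Qed.

Lemma Csum_first (f : nat -> C) (n : nat) :
  Csum f (S n) = (f O + Csum (fun i => f (S i)) n)%C.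
Proof. induction n as [|n IH]; [|rewrite Csum_last, IH]; simpl; ring. Qed.

Lemma Csum_RtoC (f : nat -> R) (n : nat) :
  Csum (fun i => RtoC (f i)) n = RtoC (sum_f_R0 f n).
Proof. induction n as [|n IH]; simpl; [|rewrite IH, RtoC_plus]; reflexivity. Qed.

Lemma Cmod_Csum (f : nat -> C) (n : nat) :
  Cmod (Csum f n) <= sum_f_R0 (fun i => Cmod (f i)) n.
Proof.
induction n as [|n IH]; simpl; [lra|].
eapply Rle_trans; [apply Cmod_triangle|lra].
Qed.

Lemma Cmod_Csum_tail (f : nat -> C) (m n : nat) : (m <= n)%nat ->
  Cmod (Csum f n - Csum f m) <=
  sum_f_R0 (fun i => Cmod (f i)) n - sum_f_R0 (fun i => Cmod (f i)) m.
Proof.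
intros H; induction H as [|n H IH].
- replace (Csum f m - Csum f m)%C with (RtoC 0) by ring; rewrite Cmod_0; lra.
- rewrite Csum_last, sum_last.
  replace (Csum f n + f (S n) - Csum f m)%C with ((Csum f n - Csum f m) + f (S n))%C by ring.
  eapply Rle_trans; [apply Cmod_triangle|lra].
Qed.

Lemma Cmod_term (c x : R) (s : C) (n : nat) : 0 <= x -> Cmod s <= x ->
  Cmod (RtoC c * s ^ n) <= Rabs c * x ^ n.
Proof.
intros Hx Hs; rewrite Cmod_mult, Cmod_pow, Cmod_R.
apply Rmult_le_compat_l; [apply Rabs_pos|].
apply pow_incr; split; [apply Cmod_ge_0|trivial].
Qed.

Lemma Csum_conv (f g : nat -> R) (s : C) (n : nat) :
  Csum (fun k => RtoC (conv f g k) * s ^ k)%C n =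
  Csum (fun i => (RtoC (f i) * s ^ i) * Csum (fun j => RtoC (g j) * s ^ j) (n - i))%C n.
Proof.
induction n as [|n IH].
{ simpl; unfold conv; simpl; rewrite RtoC_mult; ring. }
rewrite !Csum_last, IH, Nat.sub_diag.
unfold conv at 1; rewrite <- Csum_RtoC, Csum_last, Nat.sub_diag.
transitivity (Csum (fun i => (RtoC (f i) * s ^ i) * Csum (fun j => RtoC (g j) * s ^ j) (n - i))%C n
 + Csum (fun i => s ^ (S n) * RtoC (f i * g (S n - i)%nat))%C n + RtoC (f (S n)) * s ^ (S n) * RtoC (g O))%C.
{ rewrite Csum_scal, RtoC_mult; ring. }
rewrite <- Csum_plus; f_equal; [|simpl; ring].
apply Csum_eq; intros i Hi.
replace (S n - i)%nat with (S (n - i)) by lia; rewrite Csum_last, RtoC_mult.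
replace (S n) with (i + S (n - i))%nat by lia; rewrite Cpow_add_r; ring.
Qed.

(** The terms missing from a Cauchy product truncated by degree are the same
    as those missing from the product of the majorants. *)
Lemma Csum_conv_defect (f g : nat -> R) (s : C) (x : R) (n : nat) :
  0 <= x -> Cmod s <= x ->
  Cmod (Csum (fun i => RtoC (f i) * s ^ i)%C n * Csum (fun i => RtoC (g i) * s ^ i)%C n
        - Csum (fun k => RtoC (conv f g k) * s ^ k)%C n) <=
  sum_f_R0 (fun i => Rabs (f i) * x ^ i) n * sum_f_R0 (fun i => Rabs (g i) * x ^ i) n
  - sum_f_R0 (conv (fun i => Rabs (f i) * x ^ i) (fun i => Rabs (g i) * x ^ i)) n.
Proof.
intros Hx Hs; rewrite Csum_conv, sum_conv.
set (G := Csum (fun i => RtoC (g i) * s ^ i)%C).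
set (A := sum_f_R0 (fun i => Rabs (g i) * x ^ i)).
replace (Csum (fun i => RtoC (f i) * s ^ i)%C n * G n
  - Csum (fun i => RtoC (f i) * s ^ i * G (n - i)%nat)%C n)%C with
  (Csum (fun i => RtoC (f i) * s ^ i * (G n - G (n - i)%nat))%C n).
2: { rewrite Cmult_comm, <- Csum_scal.
  rewrite (Csum_eq (fun i => RtoC (f i) * s ^ i * (G n - G (n - i)%nat))%C
   (fun i => G n * (RtoC (f i) * s ^ i) + (-(1)) * (RtoC (f i) * s ^ i * G (n - i)%nat))%C).
  - rewrite Csum_plus, !Csum_scal; ring.
  - intros i _; ring. }
eapply Rle_trans; [apply Cmod_Csum|].
rewrite (Rmult_comm _ (A n)), <- sum_scal.
apply Rle_trans with (sum_f_R0 (fun i => Rabs (f i) * x ^ i * (A n - A (n - i)%nat)) n).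
2: { right; rewrite (sum_eq _ (fun i => A n * (Rabs (f i) * x ^ i) + (-1) * (Rabs (f i) * x ^ i * A (n - i)%nat))).
  - rewrite sum_plus, (sum_scal (-1)); ring.
  - intros i _; ring. }
apply sum_Rle; intros i Hi; rewrite Cmod_mult.
apply Rmult_le_compat; try apply Cmod_ge_0; [apply Cmod_term; trivial|].
eapply Rle_trans; [apply Cmod_Csum_tail; lia|].
assert (HT : forall m k, (m <= k)%nat ->
  sum_f_R0 (fun i => Cmod (RtoC (g i) * s ^ i)) k - sum_f_R0 (fun i => Cmod (RtoC (g i) * s ^ i)) m
  <= A k - A m).
{ intros m k H; induction H as [|k H IH]; [lra|].
  unfold A; rewrite !sum_last; fold A.
  assert (Ht := Cmod_term (g (S k)) x s (S k) Hx Hs); lra. }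
apply HT; lia.
Qed.

(** * Truncations satisfy the differential equation approximately *)

Definition Cpoly (b : nat -> R) (N : nat) (s : C) : C :=
  Csum (fun n => RtoC (b n) * s ^ n)%C N.

Definition Cpoly' (b : nat -> R) (N : nat) (s : C) : C :=
  Csum (fun n => RtoC (b n) * (RtoC (INR n) * s ^ pred n))%C N.

Lemma Cpoly_index (b : nat -> R) (N : nat) (s : C) :
  (s * Cpoly' b N s)%C = Cpoly (fun n => INR n * b n) N s.
Proof.
unfold Cpoly', Cpoly; rewrite <- Csum_scal; apply Csum_eq; intros [|n] _.
- simpl; rewrite !RtoC_mult; ring.
- rewrite RtoC_mult; simpl pred; rewrite Cpow_S; ring.
Qed.

Lemma Cmod_Cpoly_index (b : nat -> R) (N : nat) (s : C) (x : R) : 0 <= x -> Cmod s <= x ->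
  Cmod (s * Cpoly' b N s) <= sum_f_R0 (fun n => INR n * Rabs (b n) * x ^ n) N.
Proof.
intros Hx Hs; rewrite Cpoly_index; eapply Rle_trans; [apply Cmod_Csum|].
apply sum_Rle; intros n _; eapply Rle_trans; [apply (Cmod_term _ x); trivial|].
rewrite Rabs_mult, (Rabs_pos_eq (INR n)) by apply pos_INR; lra.
Qed.

(** The first summand bounds the term of degree [N] of the derivative that a
    partial sum lacks, the second what the product exceeds the truncated Cauchy
    product by. *)
Definition ode_defect_bound (q x : R) (N : nat) : R :=
  / x * (INR (S N) * Rabs (coef (S N) q) * x ^ S N) +
  (sum_f_R0 (fun n => INR n * Rabs (coef n q) * x ^ n) N
   * sum_f_R0 (fun n => Rabs (coef n q) * x ^ n) N
   - sum_f_R0 (conv (fun n => INR n * Rabs (coef n q) * x ^ n)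
                    (fun n => Rabs (coef n q) * x ^ n)) N).

(** Up to degree [N - 1] the coefficients of the left-hand side vanish by
    [ode_coef_zero]; there remain one term of degree [N] and the part of the
    product [(s P') P] of degree greater than [N]. *)
Lemma Cpoly_ode (q x : R) (s : C) (N : nat) : 0 < x -> Cmod s <= x ->
  let a := fun n => coef n q in
  Cmod (Cpoly' a N s * (1 + s - s * (RtoC q - Cpoly a N s)) - (RtoC q - Cpoly a N s))
  <= ode_defect_bound q x N.
Proof.
intros Hx Hs a.
set (ia := fun i => INR i * a i).
set (T := Csum (fun k => RtoC (conv ia a k) * s ^ k)%C N).
assert (E : Cpoly' a (S N) s =
  (RtoC q - (1 - RtoC q) * (s * Cpoly' a N s) - Cpoly a N s - T)%C).
{ rewrite Cpoly_index; unfold Cpoly' at 1; rewrite Csum_first; simpl (INR 0).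
  rewrite (Csum_eq _ (fun n => RtoC (match n with O => q | _ => 0 end) * s ^ n
   + (- (1 - RtoC q)) * (RtoC (INR n * a n) * s ^ n) + (-(1)) * (RtoC (a n) * s ^ n)
   + (-(1)) * (RtoC (conv ia a n) * s ^ n))%C).
  - rewrite !Csum_plus, !Csum_scal; fold T; unfold Cpoly.
    assert (E0 : Csum (fun n => RtoC (match n with O => q | _ => 0 end) * s ^ n)%C N = RtoC q).
    { clear; induction N as [|N IH]; [simpl; ring|rewrite Csum_last, IH; ring]. }
    rewrite E0; ring.
  - intros n _; simpl pred.
    assert (H := ode_coef_zero n q); unfold ode_coef, coef_sq in H.
    rewrite <- conv_index in H; fold a in H.
    change (fun i => INR i * coef i q) with ia in H.
    assert (H' : a (S n) * INR (S n) = match n with O => q | _ => 0 end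
      - (1 - q) * (INR n * a n) - a n - conv ia a n).
    { change (coef (S n) q) with (a (S n)) in H; change (coef n q) with (a n) in H.
      generalize dependent (conv ia a n); destruct n; intros; lra. }
    replace (RtoC (a (S n)) * (RtoC (INR (S n)) * s ^ n))%C with
      (RtoC (a (S n) * INR (S n)) * s ^ n)%C by (rewrite RtoC_mult; ring).
    rewrite H', !RtoC_minus, RtoC_mult, RtoC_minus; ring. }
assert (E1 : Cpoly' a (S N) s = (Cpoly' a N s + RtoC (INR (S N) * a (S N)) * s ^ N)%C).
{ unfold Cpoly'; rewrite Csum_last, RtoC_mult; simpl pred; ring. }
replace (Cpoly' a N s * (1 + s - s * (RtoC q - Cpoly a N s)) - (RtoC q - Cpoly a N s))%C with
  (- (RtoC (INR (S N) * a (S N)) * s ^ N) + ((s * Cpoly' a N s) * Cpoly a N s - T))%C.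
2: { rewrite E1 in E.
  match type of E with (_ + ?t)%C = ?u =>
    assert (E2 : Cpoly' a N s = (u - t)%C) by (rewrite <- E; ring);
    transitivity ((u - t) + (Cpoly' a N s * (s - s * (RtoC q - Cpoly a N s)) - (RtoC q - Cpoly a N s)))%C;
    [ring|rewrite <- E2; ring] end. }
eapply Rle_trans; [apply Cmod_triangle|]; apply Rplus_le_compat.
- rewrite Cmod_opp; eapply Rle_trans; [apply (Cmod_term _ x); [lra|exact Hs]|].
  rewrite Rabs_mult, (Rabs_pos_eq (INR (S N))) by apply pos_INR.
  right; unfold a; simpl; field; lra.
- rewrite Cpoly_index; fold ia; unfold Cpoly, T.
  eapply Rle_trans; [apply (Csum_conv_defect _ _ s x N); [lra|exact Hs]|].
  assert (EA : forall n, Rabs (ia n) * x ^ n = INR n * Rabs (coef n q) * x ^ n).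
  { intros n; unfold ia; rewrite Rabs_mult, (Rabs_pos_eq (INR n)) by apply pos_INR; reflexivity. }
  rewrite (sum_eq _ _ N (fun i _ => EA i)).
  apply Rplus_le_compat_l, Ropp_le_contravar; right.
  apply sum_eq; intros n _; unfold conv; apply sum_eq; intros i _; rewrite EA; reflexivity.
Qed.

(** The subtracted sum is a partial sum of the Cauchy product of two absolutely
    convergent series, hence tends to the product of their sums. *)
Lemma ode_defect_bound_lim (q s0 x : R) : 0 < x < s0 ->
  ex_series (fun n => coef n q * s0 ^ n) ->
  ex_series (fun n => INR n * Rabs (coef n q) * x ^ n) /\
  is_lim_seq (ode_defect_bound q x) 0.
Proof.
intros [Hx Hs] H.
assert (HR : Rbar_le s0 (CV_radius (fun n => coef n q))).
{ apply Rbar_not_lt_le; intros Hlt.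
  apply (CV_disk_outside (fun n => coef n q) s0).
  - rewrite Rabs_pos_eq by lra; exact Hlt.
  - apply ex_series_lim_0, H. }
assert (Hlt : Rbar_lt (Rabs x) (CV_radius (fun n => coef n q))).
{ rewrite Rabs_pos_eq by lra; eapply Rbar_lt_le_trans; [|exact HR]; exact Hs. }
assert (Ha := CV_disk_inside _ _ Hlt).
rewrite <- CV_radius_derive in Hlt.
assert (Hd := CV_disk_inside _ _ Hlt).
assert (Hn : ex_series (fun n => INR n * Rabs (coef n q) * x ^ n)).
{ apply ex_series_incr_1.
  apply (ex_series_ext (fun n => x * Rabs (PS_derive (fun n => coef n q) n * x ^ n))).
  - intros n; unfold PS_derive.
    rewrite !Rabs_mult, (Rabs_pos_eq (INR (S n))), (Rabs_pos_eq (x ^ n));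
      [simpl; ring|apply pow_le; lra|apply pos_INR].
  - apply (ex_series_scal_l (K := R_AbsRing) x (fun n => Rabs (PS_derive (fun n => coef n q) n * x ^ n))), Hd. }
assert (Ha' : ex_series (fun n => Rabs (coef n q) * x ^ n)).
{ eapply ex_series_ext; [|exact Ha]; intros n; simpl.
  rewrite Rabs_mult, (Rabs_pos_eq (x ^ n)); [reflexivity|apply pow_le; lra]. }
split; [exact Hn|].
assert (Pn : forall n, 0 <= INR n * Rabs (coef n q) * x ^ n).
{ intros n; apply Rmult_le_pos; [apply Rmult_le_pos; [apply pos_INR|apply Rabs_pos]|apply pow_le; lra]. }
assert (Pa : forall n, 0 <= Rabs (coef n q) * x ^ n).
{ intros n; apply Rmult_le_pos; [apply Rabs_pos|apply pow_le; lra]. }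
assert (L0 : is_lim_seq (fun N => INR (S N) * Rabs (coef (S N) q) * x ^ S N) 0).
{ apply (is_lim_seq_incr_1 (fun n => INR n * Rabs (coef n q) * x ^ n)), ex_series_lim_0, Hn. }
destruct Hn as [ln Hn]; destruct Ha' as [la Ha'].
assert (Hc := is_series_mult _ _ _ _ Hn Ha').
unfold ode_defect_bound.
replace (Finite 0) with (Finite (/ x * 0 + (ln * la - ln * la))) by (f_equal; ring).
apply is_lim_seq_plus'; [|apply is_lim_seq_minus'; [apply is_lim_seq_mult'|]].
- apply (is_lim_seq_scal_l _ (/ x) 0), L0.
- eapply is_lim_seq_ext; [|exact Hn]; intros n; simpl; rewrite sum_n_Reals; reflexivity.
- eapply is_lim_seq_ext; [|exact Ha']; intros n; simpl; rewrite sum_n_Reals; reflexivity.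
- eapply is_lim_seq_ext; [|apply Hc]; [intros n; simpl; rewrite sum_n_Reals; reflexivity| |].
  + exists ln; eapply is_series_ext; [|exact Hn]; intros n; simpl; symmetry; apply Rabs_pos_eq, Pn.
  + exists la; eapply is_series_ext; [|exact Ha']; intros n; simpl; symmetry; apply Rabs_pos_eq, Pa.
Qed.

(** * Complex-valued functions of a real variable *)

Definition is_Cder (f : R -> C) (x : R) (l : C) : Prop :=
  is_derive (fun t => Re (f t)) x (Re l) /\ is_derive (fun t => Im (f t)) x (Im l).

Lemma is_Cder_ext (f g : R -> C) (x : R) (l : C) :
  (forall t, f t = g t) -> is_Cder f x l -> is_Cder g x l.
Proof.
intros E [H1 H2]; split; eapply is_derive_ext; try eassumption;
  intros t; simpl; rewrite E; reflexivity.
Qed.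

Lemma is_Cder_const (c : C) (x : R) : is_Cder (fun _ => c) x 0.
Proof. split; apply (@is_derive_const R_AbsRing R_NormedModule). Qed.

Lemma is_Cder_plus (f g : R -> C) (x : R) (l m : C) :
  is_Cder f x l -> is_Cder g x m -> is_Cder (fun t => (f t + g t)%C) x (l + m)%C.
Proof. intros [H1 H2] [H3 H4]; split; apply is_derive_Rplus; assumption. Qed.

Lemma is_Cder_mult (f g : R -> C) (x : R) (l m : C) :
  is_Cder f x l -> is_Cder g x m ->
  is_Cder (fun t => (f t * g t)%C) x (l * g x + f x * m)%C.
Proof.
intros [H1 H2] [H3 H4]; split.
- replace (Re (l * g x + f x * m)%C) with
   ((Re l * Re (g x) + Re (f x) * Re m) + (-1) * (Im l * Im (g x) + Im (f x) * Im m))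
   by (unfold Re, Im; simpl; ring).
  apply (is_derive_ext (fun t => Re (f t) * Re (g t) + (-1) * (Im (f t) * Im (g t)))).
  { intros t; unfold Re, Im, Cmult; simpl.
    match goal with |- ?u = ?w => change (@eq R u w) end; ring. }
  apply is_derive_Rplus; [|apply is_derive_scal]; apply is_derive_Rmult; assumption.
- replace (Im (l * g x + f x * m)%C) with
   ((Re l * Im (g x) + Re (f x) * Im m) + (Im l * Re (g x) + Im (f x) * Re m))
   by (unfold Re, Im; simpl; ring).
  apply is_derive_Rplus; apply is_derive_Rmult; assumption.
Qed.

Lemma is_Cder_scal (c : C) (f : R -> C) (x : R) (l : C) :
  is_Cder f x l -> is_Cder (fun t => (c * f t)%C) x (c * l)%C.
Proof.
intros H; replace (c * l)%C with (0 * f x + c * l)%C by ring.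
apply (is_Cder_mult (fun _ => c)); [apply is_Cder_const|exact H].
Qed.

Lemma is_Cder_pow (f : R -> C) (x : R) (l : C) (n : nat) : is_Cder f x l ->
  is_Cder (fun t => (f t ^ n)%C) x (RtoC (INR n) * f x ^ pred n * l)%C.
Proof.
intros H; induction n as [|n IH].
- simpl; replace (0 * 1 * l)%C with (RtoC 0) by ring; apply is_Cder_const.
- apply (is_Cder_ext (fun t => f t * f t ^ n)%C); [intros t; symmetry; apply Cpow_S|].
  replace (RtoC (INR (S n)) * f x ^ pred (S n) * l)%C with
    (l * f x ^ n + f x * (RtoC (INR n) * f x ^ pred n * l))%C.
  + apply (is_Cder_mult f); assumption.
  + rewrite S_INR, RtoC_plus; simpl pred; destruct n as [|n]; [simpl; ring|].
    rewrite Cpow_S; simpl pred; ring.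
Qed.

Lemma is_Cder_Csum (f : nat -> R -> C) (l : nat -> C) (x : R) (n : nat) :
  (forall k, is_Cder (f k) x (l k)) ->
  is_Cder (fun t => Csum (fun k => f k t) n) x (Csum l n).
Proof.
intros H; induction n as [|n IH]; [apply H|].
apply is_Cder_plus; [exact IH|apply H].
Qed.

Lemma is_Cder_Cpoly (b : nat -> R) (N : nat) (f : R -> C) (x : R) (l : C) :
  is_Cder f x l -> is_Cder (fun t => Cpoly b N (f t)) x (Cpoly' b N (f x) * l)%C.
Proof.
intros H; unfold Cpoly, Cpoly'.
rewrite Cmult_comm, <- Csum_scal.
apply (is_Cder_Csum (fun k t => (RtoC (b k) * f t ^ k)%C)); intros k.
replace (l * (b k * (INR k * f x ^ pred k)))%C with
  (RtoC (b k) * (RtoC (INR k) * f x ^ pred k * l))%C by ring.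
apply is_Cder_scal, is_Cder_pow, H.
Qed.

Lemma is_Cder_Cexp (f : R -> C) (x : R) (l : C) :
  is_Cder f x l -> is_Cder (fun t => Cexp (f t)) x (Cexp (f x) * l)%C.
Proof.
intros [H1 H2].
set (u := fun t => Re (f t)) in *; set (v := fun t => Im (f t)) in *.
assert (Eu := is_derive_unique _ _ _ H1); assert (Ev := is_derive_unique _ _ _ H2).
split.
- apply (is_derive_ext (fun t => exp (u t) * cos (v t))); [reflexivity|].
  auto_derive; [repeat split; eexists; eassumption|].
  replace (Derive (fun t : R => u t) x) with (Re l) by (symmetry; exact Eu).
  replace (Derive (fun t : R => v t) x) with (Im l) by (symmetry; exact Ev).
  unfold u, v, Cexp, Re, Im; simpl; ring.
- apply (is_derive_ext (fun t => exp (u t) * sin (v t))); [reflexivity|].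
  auto_derive; [repeat split; eexists; eassumption|].
  replace (Derive (fun t : R => u t) x) with (Re l) by (symmetry; exact Eu).
  replace (Derive (fun t : R => v t) x) with (Im l) by (symmetry; exact Ev).
  unfold u, v, Cexp, Re, Im; simpl; ring.
Qed.

Lemma is_Cder_inv (f : R -> C) (x : R) (l : C) : f x <> 0 ->
  is_Cder f x l -> is_Cder (fun t => (/ f t)%C) x (- l * (/ f x * / f x))%C.
Proof.
intros Hn [H1 H2].
set (u := fun t => Re (f t)) in *; set (v := fun t => Im (f t)) in *.
assert (Eu := is_derive_unique _ _ _ H1); assert (Ev := is_derive_unique _ _ _ H2).
assert (Hm : u x ^ 2 + v x ^ 2 <> 0).
{ intros E; apply Hn, injective_projections; unfold u, v, Re, Im in E; simpl in *; nra. }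
split.
- apply (is_derive_ext (fun t => u t / (u t ^ 2 + v t ^ 2))); [reflexivity|].
  auto_derive; [repeat split; try (eexists; eassumption); exact Hm|].
  replace (Derive (fun t : R => u t) x) with (Re l) by (symmetry; exact Eu).
  replace (Derive (fun t : R => v t) x) with (Im l) by (symmetry; exact Ev).
  unfold u, v, Re, Im in *; simpl in *; field; lra.
- apply (is_derive_ext (fun t => - v t / (u t ^ 2 + v t ^ 2))); [reflexivity|].
  auto_derive; [repeat split; try (eexists; eassumption); exact Hm|].
  replace (Derive (fun t : R => u t) x) with (Re l) by (symmetry; exact Eu).
  replace (Derive (fun t : R => v t) x) with (Im l) by (symmetry; exact Ev).
  unfold u, v, Re, Im in *; simpl in *; field; lra.
Qed.

Lemma Cmod2_sum (c : C) : Cmod c ^ 2 = Re c * Re c + Im c * Im c.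
Proof. rewrite Cmod2_alt; simpl; ring. Qed.

Lemma is_derive_Cmod2 (f : R -> C) (x : R) (l : C) : is_Cder f x l ->
  is_derive (fun t => Cmod (f t) ^ 2) x (2 * (Re (f x) * Re l + Im (f x) * Im l)).
Proof.
intros [H1 H2].
apply (is_derive_ext (fun t => Re (f t) * Re (f t) + Im (f t) * Im (f t))).
{ intros t; symmetry; apply Cmod2_sum. }
replace (2 * (Re (f x) * Re l + Im (f x) * Im l)) with
  ((Re l * Re (f x) + Re (f x) * Re l) + (Im l * Im (f x) + Im (f x) * Im l)) by ring.
apply is_derive_Rplus; apply is_derive_Rmult; assumption.
Qed.

Lemma inner_le_Cmod (u v : C) : Re u * Re v + Im u * Im v <= Cmod u * Cmod v.
Proof.
rewrite <- (Cmod_conj u), <- Cmod_mult.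
eapply Rle_trans; [|apply re_le_Cmod]; eapply Rle_trans; [|apply Rle_abs].
right; unfold Re, Im; simpl; ring.
Qed.

(** Gronwall's inequality, for the squared modulus because it is differentiable
    even where [g] vanishes: [(|g| ^ 2 + e ^ 2) exp (- (2 k + 1) x)] decreases. *)
Lemma gronwall (g : R -> C) (g' : R -> C) (k e : R) : 0 <= k -> 0 <= e ->
  (forall x, 0 <= x <= 1 -> is_Cder g x (g' x)) ->
  (forall x, 0 <= x <= 1 -> Cmod (g' x) <= k * Cmod (g x) + e) ->
  Cmod (g 1) ^ 2 <= exp (2 * k + 1) * (Cmod (g 0) ^ 2 + e ^ 2).
Proof.
intros Hk He Hd Hb.
set (F := fun x => Cmod (g x) ^ 2).
set (F' := fun x => 2 * (Re (g x) * Re (g' x) + Im (g x) * Im (g' x))).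
set (G := fun x => (F x + e ^ 2) * exp (- (2 * k + 1) * x)).
assert (HG : forall x, 0 <= x <= 1 ->
  is_derive G x ((F' x - (2 * k + 1) * (F x + e ^ 2)) * exp (- (2 * k + 1) * x))).
{ intros x Hx; assert (HF := is_derive_Cmod2 g x _ (Hd x Hx)); fold (F' x) in HF.
  unfold G.
  replace ((F' x - (2 * k + 1) * (F x + e ^ 2)) * exp (- (2 * k + 1) * x)) with
    ((F' x + 0) * exp (- (2 * k + 1) * x) + (F x + e ^ 2) * (- (2 * k + 1) * exp (- (2 * k + 1) * x))) by ring.
  apply (is_derive_Rmult (fun x => F x + e ^ 2) (fun x => exp (- (2 * k + 1) * x))).
  - apply (is_derive_Rplus F (fun _ => e ^ 2)); [exact HF|].
    apply (@is_derive_const R_AbsRing R_NormedModule).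
  - auto_derive; trivial; ring. }
destruct (MVT_gen G 0 1 (fun x => (F' x - (2 * k + 1) * (F x + e ^ 2)) * exp (- (2 * k + 1) * x)))
  as [c [Hc E]].
- rewrite Rmin_left, Rmax_right by lra; intros x Hx; apply HG; lra.
- rewrite Rmin_left, Rmax_right by lra; intros x Hx.
  apply derivable_continuous_pt; eexists; apply is_derive_Reals, HG, Hx.
- rewrite Rmin_left, Rmax_right in Hc by lra.
  assert (H1 : F' c <= (2 * k + 1) * (F c + e ^ 2)).
  { assert (Hi := inner_le_Cmod (g c) (g' c)); assert (Hg := Hb c Hc).
    assert (H0 := Cmod_ge_0 (g c)); assert (H0' := Cmod_ge_0 (g' c)).
    unfold F', F; assert (Cmod (g c) * Cmod (g' c) <= Cmod (g c) * (k * Cmod (g c) + e)) by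
      (apply Rmult_le_compat_l; lra).
    assert (0 <= (Cmod (g c) - e) ^ 2) by apply pow2_ge_0.
    assert (0 <= k * e ^ 2) by (apply Rmult_le_pos; [lra|apply pow2_ge_0]).
    simpl in *; nra. }
  assert (HE := exp_pos (- (2 * k + 1) * c)).
  assert (H2 : G 1 <= G 0) by nra.
  unfold G in H2; rewrite Rmult_0_r, exp_0, Rmult_1_r in H2; unfold F in H2.
  rewrite Rmult_1_r, exp_Ropp in H2; set (M := exp (2 * k + 1)) in *.
  assert (HM : 0 < M) by apply exp_pos.
  apply Rmult_le_compat_r with (r := M) in H2; [|lra].
  rewrite Rmult_assoc, Rinv_l, Rmult_1_r in H2 by lra.
  assert (0 <= e ^ 2) by apply pow2_ge_0; lra.
Qed.

(** * Continuation of the inverse function along a segment *)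

(** The map that the power series inverts. *)
Definition inv_sum (q : R) (v : C) : C := ((1 - Cexp (- v)) / (RtoC q - v))%C.

Lemma inv_sumE (q : R) (v : C) : (RtoC q - v)%C <> 0 ->
  (inv_sum q v * (RtoC q - v))%C = (1 - Cexp (- v))%C.
Proof. intros H; unfold inv_sum; field; exact H. Qed.

(** Let [g] be the difference between a truncated series evaluated at
    [inv_sum q v] and [v].  Along a segment, [g] satisfies a linear
    differential equation, homogeneous up to the defect of the truncation, so
    that a small [g] stays small: no choice of a branch has to be made. *)
Lemma continuation_segment (q s0 x delta : R) (v d : C) :
  0 < x < s0 -> 0 < delta -> ex_series (fun n => coef n q * s0 ^ n) ->
  (forall t, 0 <= t <= 1 -> delta <= Cmod (RtoC q - (v + RtoC t * d))) ->
  (forall t, 0 <= t <= 1 -> Cmod (inv_sum q (v + RtoC t * d)) <= x) ->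
  is_lim_seq (fun N => Cmod (Cpoly (fun n => coef n q) N (inv_sum q v) - v) ^ 2) 0 ->
  is_lim_seq (fun N => Cmod (Cpoly (fun n => coef n q) N (inv_sum q (v + d)) - (v + d)) ^ 2) 0.
Proof.
intros Hx Hdl Hs Hden Hsm H0.
destruct (ode_defect_bound_lim q s0 x Hx Hs) as [[K HK] He].
assert (HK' : forall N, sum_f_R0 (fun n => INR n * Rabs (coef n q) * x ^ n) N <= K).
{ intros N; rewrite <- sum_n_Reals; apply is_lim_seq_incr_compare; [exact HK|].
  intros n; rewrite !sum_n_Reals, sum_last.
  assert (0 <= INR (S n) * Rabs (coef (S n) q) * x ^ S n); [|lra].
  apply Rmult_le_pos; [apply Rmult_le_pos; [apply pos_INR|apply Rabs_pos]|apply pow_le; lra]. }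
set (a := fun n => coef n q).
set (w := fun t : R => (v + RtoC t * d)%C).
set (s := fun t => inv_sum q (w t)).
set (D := fun t => (RtoC q - w t)%C).
assert (HK0 : 0 <= K).
{ specialize (HK' O); simpl in HK'; lra. }
assert (HD : forall t, 0 <= t <= 1 -> D t <> 0).
{ intros t Ht E; specialize (Hden t Ht); fold (w t) in Hden; fold (D t) in Hden.
  rewrite E, Cmod_0 in Hden; lra. }
assert (Hw : forall t, is_Cder w t d).
{ intros t; assert (H : is_Cder w t (0 + (RtoC 1 * d + RtoC t * 0))%C).
  - apply is_Cder_plus; [apply is_Cder_const|].
    apply (is_Cder_mult RtoC (fun _ => d)); [|apply is_Cder_const].
    split; simpl; auto_derive; trivial.
  - replace (0 + (RtoC 1 * d + RtoC t * 0))%C with d in H by ring; exact H. }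
assert (Hs' : forall t, 0 <= t <= 1 -> is_Cder s t ((Cexp (- w t) + s t) * d / D t)%C).
{ intros t Ht; unfold s, inv_sum, Cdiv.
  replace ((Cexp (- w t) + (1 - Cexp (- w t)) * / (RtoC q - w t)) * d * / D t)%C with
   ((0 + - (1) * (Cexp (- w t) * (- (1) * d))) * / (RtoC q - w t)
    + (1 - Cexp (- w t)) * (- (0 + - (1) * d) * (/ (RtoC q - w t) * / (RtoC q - w t))))%C
   by (unfold D; field; apply HD, Ht).
  apply (is_Cder_mult (fun t => 1 - Cexp (- w t))%C (fun t => / (RtoC q - w t))%C).
  - apply (is_Cder_ext (fun t => 1 + - (1) * Cexp (- (1) * w t))%C).
    { intros u; replace (- (1) * w u)%C with (- w u)%C by ring; ring. }
    apply is_Cder_plus; [apply is_Cder_const|]; apply is_Cder_scal.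
    replace (- w t)%C with (- (1) * w t)%C by ring.
    apply (is_Cder_Cexp (fun t => - (1) * w t)%C), is_Cder_scal, Hw.
  - apply (is_Cder_inv (fun t => RtoC q - w t)%C); [apply HD, Ht|].
    apply (is_Cder_ext (fun t => RtoC q + - (1) * w t)%C); [intros u; ring|].
    apply is_Cder_plus; [apply is_Cder_const|]; apply is_Cder_scal, Hw. }
set (M := Cmod d / delta).
assert (HM : 0 <= M).
{ apply Rmult_le_pos; [apply Cmod_ge_0|left; apply Rinv_0_lt_compat, Hdl]. }
assert (Hineq : forall N,
  Cmod (Cpoly a N (s 1) - w 1) ^ 2 <=
  exp (2 * (M * (1 + K)) + 1) *
   (Cmod (Cpoly a N (s 0) - w 0) ^ 2 + (M * ode_defect_bound q x N) ^ 2)).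
{ intros N.
  assert (Hsx : forall t, 0 <= t <= 1 -> Cmod (s t) <= x) by (intros t Ht; apply Hsm, Ht).
  assert (HeN : 0 <= ode_defect_bound q x N).
  { eapply Rle_trans; [apply Cmod_ge_0|]; apply (Cpoly_ode q x (s 0) N); [lra|apply Hsx; lra]. }
  apply (gronwall (fun t => Cpoly a N (s t) - w t)%C
    (fun t => Cpoly' a N (s t) * ((Cexp (- w t) + s t) * d / D t) + - (1) * d)%C).
  - apply Rmult_le_pos; lra.
  - apply Rmult_le_pos; lra.
  - intros t Ht.
    apply (is_Cder_ext (fun t => Cpoly a N (s t) + - (1) * w t)%C); [intros u; ring|].
    apply is_Cder_plus; [apply is_Cder_Cpoly, Hs', Ht|apply is_Cder_scal, Hw].
  - intros t Ht; set (P := Cpoly a N (s t)); set (P' := Cpoly' a N (s t)).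
    set (E := (P' * (1 + s t - s t * (RtoC q - P)) - (RtoC q - P))%C).
    assert (HE : Cmod E <= ode_defect_bound q x N).
    { apply (Cpoly_ode q x (s t) N); [lra|apply Hsx, Ht]. }
    assert (HsP : Cmod (s t * P') <= K).
    { eapply Rle_trans; [|apply (HK' N)]; apply Cmod_Cpoly_index; [lra|apply Hsx, Ht]. }
    (* The relation makes the derivative of [g] proportional to [g], up to [E]. *)
    assert (Hrel : Cexp (- w t) = (1 - s t * D t)%C).
    { unfold s, D; rewrite inv_sumE by (apply HD, Ht); ring. }
    replace (P' * ((Cexp (- w t) + s t) * d / D t) + - (1) * d)%C with
      (d / D t * (- ((1 + s t * P') * (P - w t)) + E))%C.
    2: { rewrite Hrel; unfold E; assert (HDt := HD t Ht).
      replace (w t) with (RtoC q - D t)%C by (unfold D; ring); field; exact HDt. }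
    rewrite Cmod_mult, Cmod_div by (apply HD, Ht).
    assert (HdD : Cmod d / Cmod (D t) <= M).
    { apply Rmult_le_compat_l; [apply Cmod_ge_0|].
      apply Rinv_le_contravar; [exact Hdl|apply Hden, Ht]. }
    assert (H2 : Cmod (- ((1 + s t * P') * (P - w t)) + E) <=
      (1 + K) * Cmod (P - w t) + ode_defect_bound q x N).
    { eapply Rle_trans; [apply Cmod_triangle|]; apply Rplus_le_compat; [|exact HE].
      rewrite Cmod_opp, Cmod_mult; apply Rmult_le_compat_r; [apply Cmod_ge_0|].
      eapply Rle_trans; [apply Cmod_triangle|]; rewrite Cmod_1; lra. }
    rewrite Rmult_assoc, <- Rmult_plus_distr_l.
    apply Rmult_le_compat; try apply Cmod_ge_0; trivial.
    apply Rmult_le_pos; [apply Cmod_ge_0|left; apply Rinv_0_lt_compat].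
    eapply Rlt_le_trans; [exact Hdl|apply Hden, Ht]. }
assert (E0 : w 0 = v) by (unfold w; ring).
assert (E1 : w 1 = (v + d)%C) by (unfold w; ring).
unfold s in Hineq; rewrite E0, E1 in Hineq.
eapply is_lim_seq_le_le; [intros N; split; [apply pow2_ge_0|apply Hineq]|apply is_lim_seq_const|].
replace (Finite 0) with (Finite (exp (2 * (M * (1 + K)) + 1) * (0 + (M * 0) * ((M * 0) * 1)))) by (f_equal; ring).
apply (is_lim_seq_scal_l _ _ (0 + (M * 0) * ((M * 0) * 1))).
apply is_lim_seq_plus'; [exact H0|]; simpl pow.
assert (HMe : is_lim_seq (fun N => M * ode_defect_bound q x N) (M * 0)) by
  (apply (is_lim_seq_scal_l _ M 0), He).
apply is_lim_seq_mult'; [exact HMe|]; apply is_lim_seq_mult'; [exact HMe|apply is_lim_seq_const].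
Qed.

(** Both [inv_sum q 0] and the partial sums at [0] vanish. *)
Lemma continuation_start (q : R) : q <> 0 ->
  is_lim_seq (fun N => Cmod (Cpoly (fun n => coef n q) N (inv_sum q 0) - 0) ^ 2) 0.
Proof.
intros Hq; apply (is_lim_seq_ext (fun _ => 0)); [|apply is_lim_seq_const].
intros N; assert (Es : inv_sum q 0 = 0).
{ unfold inv_sum, Cexp; replace (Re (- 0)) with 0 by (simpl; ring).
  replace (Im (- 0)) with 0 by (simpl; ring); rewrite exp_0, cos_0, sin_0.
  replace (1 - ((1 * 1)%R, (1 * 0)%R))%C with (RtoC 0).
  - unfold Cdiv; ring.
  - apply injective_projections; simpl; ring. }
assert (EP : Cpoly (fun n => coef n q) N 0 = 0).
{ unfold Cpoly; rewrite (Csum_eq _ (fun _ => RtoC 0 * RtoC 0)%C); [rewrite Csum_scal; ring|].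
  intros [|n] _; [rewrite coef_0|rewrite Cpow_S]; ring. }
rewrite Es, EP; replace (0 - 0)%C with (RtoC 0) by ring; rewrite Cmod_0; ring.
Qed.

(** The hypothesis [Cexp (- v) + inv_sum q v = 0] says that [v] is a critical
    point.  There the factor [1 + s - s (q - P)] of the differential equation
    tends to 0 with [P - v], while [P'] stays bounded; so [q - P] tends to 0,
    contrary to [q <> v]. *)
Lemma continuation_not_critical (q s0 x : R) (v : C) :
  0 < x < s0 -> ex_series (fun n => coef n q * s0 ^ n) ->
  (RtoC q - v)%C <> 0 -> Cmod (inv_sum q v) <= x ->
  (Cexp (- v) + inv_sum q v)%C = 0 ->
  ~ is_lim_seq (fun N => Cmod (Cpoly (fun n => coef n q) N (inv_sum q v) - v) ^ 2) 0.
Proof.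
intros Hx Hs Hqv Hsx Hcrit Hl.
destruct (ode_defect_bound_lim q s0 x Hx Hs) as [[K HK] He].
assert (HK' : forall N, sum_f_R0 (fun n => INR n * Rabs (coef n q) * x ^ n) N <= K).
{ intros N; rewrite <- sum_n_Reals; apply is_lim_seq_incr_compare; [exact HK|].
  intros n; rewrite !sum_n_Reals, sum_last.
  assert (0 <= INR (S n) * Rabs (coef (S n) q) * x ^ S n); [|lra].
  apply Rmult_le_pos; [apply Rmult_le_pos; [apply pos_INR|apply Rabs_pos]|apply pow_le; lra]. }
set (s := inv_sum q v) in *; set (a := fun n => coef n q) in *.
assert (H1 : forall N, Cmod (RtoC q - v) <=
  (K + 1) * Cmod (Cpoly a N s - v) + ode_defect_bound q x N).
{ intros N; assert (HE := Cpoly_ode q x s N (proj1 Hx) Hsx); simpl in HE; fold a in HE.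
  assert (HP := Cmod_Cpoly_index a N s x (Rlt_le _ _ (proj1 Hx)) Hsx).
  assert (Hrel : Cexp (- v) = (1 - s * (RtoC q - v))%C).
  { unfold s; rewrite inv_sumE by exact Hqv; ring. }
  rewrite Hrel in Hcrit.
  set (P := Cpoly a N s) in *; set (P' := Cpoly' a N s) in *.
  set (E := (P' * (1 + s - s * (RtoC q - P)) - (RtoC q - P))%C) in HE.
  replace (RtoC q - v)%C with ((s * P' + 1) * (P - v) + - E)%C.
  2: { unfold E; transitivity (RtoC q - v - P' * (1 - s * (RtoC q - v) + s))%C; [ring|].
    rewrite Hcrit; ring. }
  eapply Rle_trans; [apply Cmod_triangle|]; rewrite Cmod_opp; apply Rplus_le_compat; [|exact HE].
  rewrite Cmod_mult; apply Rmult_le_compat_r; [apply Cmod_ge_0|].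
  eapply Rle_trans; [apply Cmod_triangle|]; rewrite Cmod_1; specialize (HK' N); unfold a in HP; lra. }
assert (Hl' : is_lim_seq (fun N => Cmod (Cpoly a N s - v)) 0).
{ apply (is_lim_seq_ext (fun N => sqrt (Cmod (Cpoly a N s - v) ^ 2))).
  - intros N; apply sqrt_pow2, Cmod_ge_0.
  - rewrite <- sqrt_0; apply (is_lim_seq_continuous sqrt); [apply continuity_pt_sqrt; lra|exact Hl]. }
assert (Hlim : Rbar_le (Cmod (RtoC q - v)) ((K + 1) * 0 + 0)).
{ apply (is_lim_seq_le (fun _ => Cmod (RtoC q - v))
   (fun N => (K + 1) * Cmod (Cpoly a N s - v) + ode_defect_bound q x N)); [exact H1|apply is_lim_seq_const|].
  apply is_lim_seq_plus'; [apply (is_lim_seq_scal_l _ (K + 1) 0), Hl'|exact He]. }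
simpl in Hlim; apply Cmod_gt_0 in Hqv; lra.
Qed.

(** * The critical curve *)

Lemma MVT_cmp (f f' : R -> R) (a b : R) : a < b ->
  (forall x, a <= x <= b -> is_derive f x (f' x)) ->
  exists c, a <= c <= b /\ f b - f a = f' c * (b - a).
Proof.
intros Hab Hd; destruct (MVT_gen f a b f') as [c [Hc E]].
- rewrite Rmin_left, Rmax_right by lra; intros x Hx; apply Hd; lra.
- rewrite Rmin_left, Rmax_right by lra; intros x Hx.
  apply derivable_continuous_pt; eexists; apply is_derive_Reals, Hd, Hx.
- rewrite Rmin_left, Rmax_right in Hc by lra; exists c; auto.
Qed.

Lemma MVT_incr (f f' : R -> R) (a b : R) : a < b ->
  (forall x, a <= x <= b -> is_derive f x (f' x)) ->
  (forall x, a <= x <= b -> 0 < f' x) -> f a < f b.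
Proof.
intros Hab Hd Hp; destruct (MVT_cmp f f' a b Hab Hd) as [c [Hc E]].
assert (0 < f' c * (b - a)) by (apply Rmult_lt_0_compat; [apply Hp, Hc|lra]); lra.
Qed.

Lemma xcos_lt_sin (x : R) : 0 < x < PI -> x * cos x < sin x.
Proof.
intros Hx.
destruct (MVT_cmp (fun x => sin x - x * cos x) (fun x => x * sin x) 0 (x / 2)) as [c [Hc E]]; [lra| |].
{ intros y _; auto_derive; trivial; ring. }
rewrite sin_0, Rmult_0_l in E.
assert (0 <= c * sin c) by (apply Rmult_le_pos; [lra|apply sin_ge_0; lra]).
assert (H2 : sin (x / 2) - x / 2 * cos (x / 2) < sin x - x * cos x).
{ apply (MVT_incr (fun x => sin x - x * cos x) (fun x => x * sin x)); [lra| |].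
  - intros y _; auto_derive; trivial; ring.
  - intros y Hy; apply Rmult_lt_0_compat; [lra|apply sin_gt_0; lra]. }
assert (0 <= c * sin c * (x / 2 - 0)) by (apply Rmult_le_pos; lra); lra.
Qed.

Lemma div_sin_incr (a b : R) : 0 < a -> a < b -> b < PI -> a / sin a < b / sin b.
Proof.
intros Ha Hab Hb.
apply (MVT_incr (fun x => x / sin x) (fun x => (sin x - x * cos x) / sin x ^ 2)); [lra| |].
- intros x Hx; assert (0 < sin x) by (apply sin_gt_0; lra).
  auto_derive; [lra|field; lra].
- intros x Hx; assert (0 < sin x) by (apply sin_gt_0; lra).
  assert (Hs := xcos_lt_sin x); apply Rdiv_lt_0_compat; [lra|apply pow_lt; lra].
Qed.

Lemma div_sin_gt_1 (x : R) : 0 < x < PI -> 1 < x / sin x.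
Proof.
intros Hx; assert (0 < sin x) by (apply sin_gt_0; lra).
assert (Hs := sin_lt_x x (proj1 Hx)).
apply Rmult_lt_reg_r with (sin x); [lra|]; field_simplify; lra.
Qed.

Lemma ln_div_sin_pos (x : R) : 0 < x < PI -> 0 < ln (x / sin x).
Proof.
intros Hx; rewrite <- ln_1; apply ln_increasing; [lra|apply div_sin_gt_1, Hx].
Qed.

Definition one_sub_cot (x : R) : R := 1 - x * (cos x / sin x).

Lemma one_sub_cot_pos (x : R) : 0 < x < PI -> 0 < one_sub_cot x.
Proof.
intros Hx; assert (0 < sin x) by (apply sin_gt_0; lra).
unfold one_sub_cot; replace (1 - x * (cos x / sin x)) with ((sin x - x * cos x) / sin x) by (field; lra).
assert (Hs := xcos_lt_sin x Hx); apply Rdiv_lt_0_compat; lra.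
Qed.

Lemma is_derive_one_sub_cot (x : R) : 0 < x < PI ->
  is_derive one_sub_cot x ((x - sin x * cos x) / sin x ^ 2).
Proof.
intros Hx; assert (0 < sin x) by (apply sin_gt_0; lra).
unfold one_sub_cot; auto_derive; [lra|].
replace ((x - sin x * cos x) / sin x ^ 2) with ((x * (sin x ^ 2 + cos x ^ 2) - sin x * cos x) / sin x ^ 2).
- field; lra.
- replace (sin x ^ 2 + cos x ^ 2) with 1 by (rewrite <- (sin2_cos2 x); unfold Rsqr; ring).
  rewrite Rmult_1_r; reflexivity.
Qed.

Lemma one_sub_cot_incr (a b : R) : 0 < a -> a < b -> b < PI ->
  one_sub_cot a < one_sub_cot b.
Proof.
intros Ha Hab Hb.
apply (MVT_incr _ (fun x => (x - sin x * cos x) / sin x ^ 2)); [lra| |].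
- intros x Hx; apply is_derive_one_sub_cot; lra.
- intros x Hx; assert (0 < sin x) by (apply sin_gt_0; lra).
  assert (sin x < x) by (apply sin_lt_x; lra).
  assert (Hc := COS_bound x).
  apply Rdiv_lt_0_compat; [nra|apply pow_lt; lra].
Qed.

(** The value of [q] for which [ln (x / sin x) + i x] is a critical point of
    [inv_sum q]. *)
Definition critical_q (x : R) : R := one_sub_cot x + ln (x / sin x).

Lemma critical_q_incr (a b : R) : 0 < a -> a < b -> b < PI ->
  critical_q a < critical_q b.
Proof.
intros Ha Hab Hb; apply Rplus_lt_compat; [apply one_sub_cot_incr; lra|].
apply ln_increasing; [|apply div_sin_incr; lra].
assert (H := div_sin_gt_1 a); lra.
Qed.

Lemma cos_ge_quad (x : R) : 0 < x -> 1 - x ^ 2 / 2 <= cos x.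
Proof.
intros Hx; replace x with (2 * (x / 2)) at 2 by field; rewrite cos_2a_sin.
assert (H := sin_lt_x (x / 2)); assert (H' := SIN_bound (x / 2)).
destruct (Rle_lt_dec 0 (sin (x / 2))).
- assert (sin (x / 2) * sin (x / 2) <= x / 2 * (x / 2)) by (apply Rmult_le_compat; lra); nra.
- destruct (Rle_lt_dec 2 x); [nra|].
  assert (0 <= sin (x / 2)); [|lra].
  apply sin_ge_0; [lra|]; assert (Hpi := PI2_3_2); lra.
Qed.

(** Both functions tend to 0 at [0], and to infinity at [PI] by
    [near_PI_bounds]; explicit bounds replace the limits. *)
Lemma near_0_bounds (x : R) : 0 < x <= 1 ->
  one_sub_cot x <= x ^ 2 /\ critical_q x <= 2 * x ^ 2.
Proof.
intros Hx; assert (Hpi := PI2_3_2).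
assert (Hs : 0 < sin x) by (apply sin_gt_0; lra).
assert (Hc := cos_ge_quad x (proj1 Hx)).
assert (Hxs := xcos_lt_sin x); assert (Hsx := sin_lt_x x (proj1 Hx)).
assert (Hs2 : x / 2 <= sin x) by nra.
assert (H : x - x * cos x <= x ^ 2 * sin x).
{ apply Rle_trans with (x * (x ^ 2 / 2)); [nra|].
  replace (x * (x ^ 2 / 2)) with (x ^ 2 * (x / 2)) by field.
  apply Rmult_le_compat_l; [apply pow2_ge_0|exact Hs2]. }
assert (H1 : one_sub_cot x <= x ^ 2).
{ unfold one_sub_cot; apply Rmult_le_reg_r with (sin x); [exact Hs|].
  replace ((1 - x * (cos x / sin x)) * sin x) with (sin x - x * cos x) by (field; lra); lra. }
split; [exact H1|]; unfold critical_q.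
assert (H2 : ln (x / sin x) <= x / sin x - 1).
{ assert (Hd := div_sin_gt_1 x); assert (He := exp_ineq1_le (ln (x / sin x))).
  rewrite exp_ln in He; lra. }
assert (H3 : x / sin x - 1 <= x ^ 2); [|lra].
apply Rmult_le_reg_r with (sin x); [exact Hs|].
replace ((x / sin x - 1) * sin x) with (x - sin x) by (field; lra); lra.
Qed.

Lemma near_PI_bounds (e : R) : 0 < e <= 1 / 2 ->
  / e <= one_sub_cot (PI - e) /\ / e <= critical_q (PI - e).
Proof.
intros He; assert (Hpi := PI2_3_2).
assert (H : / e <= one_sub_cot (PI - e)).
{ unfold one_sub_cot; rewrite <- Rtrigo_facts.sin_pi_minus, Rtrigo_facts.cos_pi_minus.
  replace (PI - (PI - e)) with e by ring.
  assert (Hs : 0 < sin e) by (apply sin_gt_0; lra).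
  assert (Hse := sin_lt_x e (proj1 He)); assert (Hc := cos_ge_quad e (proj1 He)).
  assert (/ e <= / sin e) by (apply Rinv_le_contravar; lra).
  assert (Hi : 0 < / sin e) by (apply Rinv_0_lt_compat; lra).
  assert (Hc' : 7 / 8 <= cos e) by nra.
  assert (Hm : 2 * (7 / 8) <= (PI - e) * cos e) by (apply Rmult_le_compat; lra).
  replace (1 - (PI - e) * (- cos e / sin e)) with (1 + ((PI - e) * cos e) * / sin e) by (field; lra).
  nra. }
split; [exact H|].
assert (Hl := ln_div_sin_pos (PI - e)); unfold critical_q; lra.
Qed.

Lemma surjective_on_0_PI (f : R -> R) (y : R) : 0 < y ->
  (forall x, 0 < x < PI -> ex_derive f x) ->
  (forall x, 0 < x <= 1 -> f x <= 2 * x ^ 2) ->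
  (forall e, 0 < e <= 1 / 2 -> / e <= f (PI - e)) ->
  exists x, 0 < x < PI /\ f x = y.
Proof.
intros Hy Hd H0 H1; assert (Hpi := PI2_3_2).
set (a := Rmin (1 / 2) (y / 2)).
assert (Ha : 0 < a) by (apply Rmin_pos; lra).
assert (Ha1 : a <= 1 / 2) by apply Rmin_l.
assert (Ha2 : a <= y / 2) by apply Rmin_r.
set (e := Rmin (1 / 2) (/ (y + 1))).
assert (He : 0 < e) by (apply Rmin_pos; [lra|apply Rinv_0_lt_compat; lra]).
assert (He1 : e <= 1 / 2) by apply Rmin_l.
assert (He2 : y + 1 <= / e).
{ rewrite <- (Rinv_inv (y + 1)); apply Rinv_le_contravar; [exact He|apply Rmin_r]. }
destruct (IVT_interv (fun x => f x - y) a (PI - e)) as [x [Hx E]].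
- intros x Hx; apply continuity_pt_minus; [|apply continuity_pt_const; intros u v; reflexivity].
  apply continuity_pt_filterlim.
  apply (ex_derive_continuous (K := R_AbsRing) (V := R_NormedModule)), Hd; lra.
- lra.
- specialize (H0 a ltac:(lra)); nra.
- specialize (H1 e ltac:(lra)); lra.
- exists x; lra.
Qed.

Lemma one_sub_cot_surj (y : R) : 0 < y -> exists x, 0 < x < PI /\ one_sub_cot x = y.
Proof.
intros Hy; apply surjective_on_0_PI; [exact Hy| | |].
- intros x Hx; eexists; apply is_derive_one_sub_cot, Hx.
- intros x Hx; destruct (near_0_bounds x Hx); nra.
- intros e He; apply near_PI_bounds, He.
Qed.

Lemma critical_q_surj (y : R) : 0 < y -> exists x, 0 < x < PI /\ critical_q x = y.
Proof.
intros Hy; apply surjective_on_0_PI; [exact Hy| | |].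
- intros x Hx; unfold critical_q.
  apply (ex_derive_plus one_sub_cot (fun x => ln (x / sin x))).
  + eexists; apply is_derive_one_sub_cot, Hx.
  + assert (0 < sin x) by (apply sin_gt_0; lra); assert (H1 := div_sin_gt_1 x Hx).
    auto_derive; lra.
- intros x Hx; apply near_0_bounds, Hx.
- intros e He; apply near_PI_bounds, He.
Qed.

(** * Divergence beyond the nearest critical value *)

Lemma Cmod_inv_sum_le (q x a b : R) : 0 <= x -> RtoC q <> (a, b) ->
  1 + exp (- a) ^ 2 - 2 * exp (- a) * cos b <= x ^ 2 * ((q - a) ^ 2 + b ^ 2) ->
  Cmod (inv_sum q (a, b)) <= x.
Proof.
intros Hx Hq H.
assert (Hne : (RtoC q - (a, b))%C <> 0).
{ intros E; apply Hq; replace (RtoC q) with ((RtoC q - (a, b)) + (a, b))%C by ring.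
  rewrite E; ring. }
unfold inv_sum; rewrite Cmod_div by exact Hne.
assert (Hpos := proj1 (Cmod_gt_0 _) Hne).
apply Rmult_le_reg_r with (Cmod (RtoC q - (a, b))); [exact Hpos|].
unfold Rdiv; rewrite Rmult_assoc, Rinv_l, Rmult_1_r by lra.
apply Rsqr_incr_0; [|apply Cmod_ge_0|apply Rmult_le_pos; lra].
rewrite !Rsqr_pow2, Rpow_mult_distr, !Cmod2_alt.
assert (Hsc := sin2_cos2 b); unfold Rsqr in Hsc.
unfold Cexp, Re, Im; simpl; rewrite sin_neg, cos_neg; simpl in H; nra.
Qed.

(** The hypotheses are the real and imaginary parts of the critical equation
    [q - v = 1 - exp v]. *)
Lemma inv_sum_critical (q a b : R) : RtoC q <> (a, b) ->
  q - a = 1 - exp a * cos b -> b = exp a * sin b ->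
  (RtoC q - (a, b))%C <> 0 /\ (Cexp (- (a, b)) + inv_sum q (a, b))%C = 0.
Proof.
intros Hq Ha Hb.
assert (Hne : (RtoC q - (a, b))%C <> 0).
{ intros E; apply Hq; replace (RtoC q) with ((RtoC q - (a, b)) + (a, b))%C by ring.
  rewrite E; ring. }
split; [exact Hne|].
assert (H : (Cexp (- (a, b)) * (RtoC q - (a, b)) + (1 - Cexp (- (a, b))))%C = 0).
{ assert (He := exp_Ropp a); assert (Hp := exp_pos a).
  assert (He' : exp (- a) * exp a = 1) by (rewrite He; field; lra).
  assert (Hsc := sin2_cos2 b); unfold Rsqr in Hsc.
  unfold Cexp, Re, Im; apply injective_projections; simpl; rewrite sin_neg, cos_neg.
  - replace (q + - a) with (1 - exp a * cos b) by lra.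
    replace (0 + - b) with (- (exp a * sin b)) by lra.
    transitivity (1 - (exp (- a) * exp a) * (sin b * sin b + cos b * cos b)); [ring|].
    rewrite He', Hsc; ring.
  - replace (q + - a) with (1 - exp a * cos b) by lra.
    replace (0 + - b) with (- (exp a * sin b)) by lra; ring. }
unfold inv_sum.
replace (Cexp (- (a, b)) + (1 - Cexp (- (a, b))) / (RtoC q - (a, b)))%C with
  ((Cexp (- (a, b)) * (RtoC q - (a, b)) + (1 - Cexp (- (a, b)))) / (RtoC q - (a, b)))%C
  by (field; exact Hne).
rewrite H; unfold Cdiv; ring.
Qed.

(** The real critical point [V > 0] has a critical value of modulus [exp (- V)].
    On the segment from [0] to [V] the modulus of [inv_sum q] is at most
    [exp (- V)], because [exp (- t)] lies above its tangent at [V]. *)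
Lemma not_ex_series_q_neg (q V l : R) : q < 0 -> 0 < V -> exp V = V + 1 - q ->
  0 < l < exp V -> ~ ex_series (fun n => coef n q * (/ l) ^ n).
Proof.
intros Hq HV HeV Hl Hs.
assert (Hx : 0 < exp (- V) < / l).
{ split; [apply exp_pos|]; rewrite exp_Ropp; apply Rinv_lt_contravar; [nra|lra]. }
assert (Hsm : forall t, 0 <= t <= V -> Cmod (inv_sum q (t, 0)) <= exp (- V)).
{ intros t Ht; apply Cmod_inv_sum_le; [lra| |].
  - intros E; injection E; lra.
  - rewrite cos_0.
    assert (He := exp_ineq1_le (V - t)).
    assert (E1 : exp (V - t) * exp (- V) = exp (- t)) by (rewrite <- exp_plus; f_equal; ring).
    assert (E2 : exp (- V) * exp V = 1) by (rewrite <- exp_plus, Rplus_opp_l; apply exp_0).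
    rewrite HeV in E2.
    assert (H1 : 1 - exp (- t) <= exp (- V) * (t - q)) by nra.
    assert (H2 : exp (- t) <= 1) by (rewrite <- exp_0; destruct (Req_dec t 0) as [->|];
      [rewrite Ropp_0; lra|left; apply exp_increasing; lra]).
    assert (H3 : (1 - exp (- t)) * (1 - exp (- t)) <= (exp (- V) * (t - q)) * (exp (- V) * (t - q)))
      by (apply Rmult_le_compat; lra).
    nra. }
assert (Hz : RtoC 0 = (0, 0)) by reflexivity.
assert (Hseg : forall t, (RtoC 0 + RtoC t * RtoC V)%C = (t * V, 0)).
{ intros t; rewrite <- RtoC_mult, <- RtoC_plus, Rplus_0_l; reflexivity. }
assert (HV0 : forall t, 0 <= t <= 1 -> 0 <= t * V <= V) by (intros t Ht; nra).
apply (continuation_not_critical q (/ l) (exp (- V)) (V, 0) Hx Hs).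
- destruct (inv_sum_critical q V 0) as [H _]; [intros E; injection E; lra| | |exact H].
  + rewrite cos_0; lra.
  + rewrite sin_0; ring.
- apply Hsm; lra.
- destruct (inv_sum_critical q V 0) as [_ H]; [intros E; injection E; lra| | |exact H].
  + rewrite cos_0; lra.
  + rewrite sin_0; ring.
- replace (V, 0) with (RtoC 0 + RtoC V)%C.
  2: { rewrite Cplus_0_l; reflexivity. }
  apply (continuation_segment q (/ l) (exp (- V)) (- q) (RtoC 0) (RtoC V) Hx); [lra|exact Hs| | |].
  + intros t Ht; rewrite Hseg.
    eapply Rle_trans; [|apply re_le_Cmod]; unfold Re; simpl.
    specialize (HV0 t Ht); rewrite Rabs_left by lra; lra.
  + intros t Ht; rewrite Hseg; apply Hsm, HV0, Ht.
  + apply continuation_start; lra.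
Qed.

(** For [q > 0] the path to the critical point [ln (y / sin y) + i y] runs
    along the real axis and then vertically; on the vertical part the modulus
    of [inv_sum] is controlled because [sin b / b] decreases. *)
Lemma not_ex_series_q_pos (y l : R) : 0 < y < PI -> 0 < l < y / sin y ->
  ~ ex_series (fun n => coef n (critical_q y) * (/ l) ^ n).
Proof.
intros Hy Hl Hs.
set (q := critical_q y) in *; set (A := one_sub_cot y); set (L := ln (y / sin y)).
assert (Hsy : 0 < sin y) by (apply sin_gt_0; lra).
assert (HA : 0 < A) by (apply one_sub_cot_pos, Hy).
assert (HL : 0 < L) by (apply ln_div_sin_pos, Hy).
assert (Hq : q - L = A) by (unfold q, critical_q, A, L; ring).
assert (HeL : exp L = y / sin y) by (apply exp_ln; assert (H := div_sin_gt_1 y Hy); lra).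
set (k := sin y / y).
assert (Hk : 0 < k) by (apply Rdiv_lt_0_compat; lra).
assert (HkL : exp (- L) = k) by (rewrite exp_Ropp, HeL; unfold k; field; lra).
assert (Hky : k * y = sin y) by (unfold k; field; lra).
assert (HkA : k * A = k - cos y) by (unfold k, A, one_sub_cot; field; lra).
assert (Hx : 0 < k < / l).
{ split; [exact Hk|]; replace k with (/ (y / sin y)) by (unfold k; field; lra).
  apply Rinv_lt_contravar; [nra|lra]. }
assert (Hver : forall b, 0 <= b <= y -> 1 + k ^ 2 - 2 * k * cos b <= k ^ 2 * (A ^ 2 + b ^ 2)).
{ intros b Hb.
  (* [g] vanishes at [y] because the critical value has modulus [k]. *)
  set (g := fun b => k ^ 2 * (A ^ 2 + b ^ 2) - (1 + k ^ 2 - 2 * k * cos b)).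
  assert (Hg : g y = 0).
  { unfold g; assert (Hsc := sin2_cos2 y); unfold Rsqr in Hsc.
    replace (k ^ 2 * (A ^ 2 + y ^ 2)) with ((k * A) ^ 2 + (k * y) ^ 2) by ring.
    rewrite HkA, Hky; simpl; nra. }
  destruct (Req_dec b y) as [->|Hne]; [unfold g in Hg; lra|].
  destruct (MVT_cmp g (fun b => 2 * k * (k * b - sin b)) b y) as [c [Hc E]]; [lra| |].
  { intros t _; unfold g; auto_derive; trivial; ring. }
  assert (Hkc : k * c <= sin c).
  { destruct (Req_dec c 0) as [->|Hc0]; [rewrite sin_0; lra|].
    destruct (Req_dec c y) as [->|Hcy]; [lra|].
    assert (Hd := div_sin_incr c y ltac:(lra) ltac:(lra) ltac:(lra)).
    assert (Hsc : 0 < sin c) by (apply sin_gt_0; lra).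
    apply Rmult_lt_compat_r with (r := sin c * k) in Hd; [|nra].
    replace (c / sin c * (sin c * k)) with (k * c) in Hd by (field; lra).
    replace (y / sin y * (sin c * k)) with (sin c) in Hd by (unfold k; field; lra); lra. }
  assert (2 * k * (k * c - sin c) * (y - b) <= 0).
  { assert (0 <= 2 * k * (sin c - k * c) * (y - b)) by (apply Rmult_le_pos; [apply Rmult_le_pos|]; lra); lra. }
  rewrite Hg in E; unfold g in E; lra. }
assert (Hhor : forall a, 0 <= a <= L -> Cmod (inv_sum q (a, 0)) <= k).
{ intros a Ha; apply Cmod_inv_sum_le; [lra| |].
  - intros E; injection E; lra.
  - rewrite cos_0; assert (H0 := Hver 0 ltac:(lra)); rewrite cos_0 in H0.
    assert (He : k <= exp (- a)).
    { rewrite <- HkL; destruct (Req_dec a L) as [->|]; [lra|left; apply exp_increasing; lra]. }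
    assert (He1 : exp (- a) <= 1).
    { rewrite <- exp_0; destruct (Req_dec a 0) as [->|]; [rewrite Ropp_0; lra|left; apply exp_increasing; lra]. }
    assert (Hk1 : 1 - k <= k * A).
    { apply Rsqr_incr_0; [unfold Rsqr; nra|lra|nra]. }
    assert (H1 : 1 - exp (- a) <= k * (q - a)) by nra.
    assert (H3 : (1 - exp (- a)) * (1 - exp (- a)) <= (k * (q - a)) * (k * (q - a)))
      by (apply Rmult_le_compat; lra).
    nra. }
assert (Hver' : forall b, 0 <= b <= y -> Cmod (inv_sum q (L, b)) <= k).
{ intros b Hb; apply Cmod_inv_sum_le; [lra| |].
  - intros E; injection E; lra.
  - rewrite HkL, Hq; apply Hver, Hb. }
assert (Hcr : (RtoC q - (L, y))%C <> 0 /\ (Cexp (- (L, y)) + inv_sum q (L, y))%C = 0).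
{ apply inv_sum_critical; [intros E; injection E; lra| |].
  - rewrite Hq, HeL; unfold A, one_sub_cot; field; lra.
  - rewrite HeL; field; lra. }
apply (continuation_not_critical q (/ l) k (L, y) Hx Hs); [apply Hcr|apply Hver'; lra|apply Hcr|].
assert (Hseg1 : forall t, (RtoC 0 + RtoC t * RtoC L)%C = (t * L, 0)).
{ intros t; rewrite <- RtoC_mult, <- RtoC_plus, Rplus_0_l; reflexivity. }
assert (Hseg2 : forall t, ((L, 0) + RtoC t * (0, y))%C = (L, t * y)).
{ intros t; apply injective_projections; simpl; ring. }
replace (L, y) with ((L, 0) + (0, y))%C by (apply injective_projections; simpl; ring).
apply (continuation_segment q (/ l) k A (L, 0) (0, y) Hx HA Hs).
- intros t Ht; rewrite Hseg2; eapply Rle_trans; [|apply re_le_Cmod]; unfold Re; simpl.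
  rewrite Rabs_pos_eq; lra.
- intros t Ht; rewrite Hseg2; apply Hver'; nra.
- replace (L, 0) with (RtoC 0 + RtoC L)%C by (rewrite Cplus_0_l; reflexivity).
  apply (continuation_segment q (/ l) k A (RtoC 0) (RtoC L) Hx HA Hs).
  + intros t Ht; rewrite Hseg1; eapply Rle_trans; [|apply re_le_Cmod]; unfold Re; simpl.
    rewrite Rabs_pos_eq; nra.
  + intros t Ht; rewrite Hseg1; apply Hhor; nra.
  + apply continuation_start; lra.
Qed.

(** * A Cauchy estimate for the coefficients *)

(** The real part of [exp (x e^(i t) - i k t)]. *)
Definition wave (x : R) (k : R) (t : R) : R :=
  exp (x * cos t) * cos (x * sin t - k * t).

Lemma continuous_wave (x k t : R) : continuous (wave x k) t.
Proof.
apply (ex_derive_continuous (K := R_AbsRing) (V := R_NormedModule)).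
unfold wave; auto_derive; trivial.
Qed.

Lemma ex_RInt_wave (x k : R) : ex_RInt (wave x k) 0 (2 * PI).
Proof.
apply (ex_RInt_continuous (V := R_CompleteNormedModule)); intros t _; apply continuous_wave.
Qed.

Lemma sin_2PI_nat (n : nat) : sin (INR n * (2 * PI)) = 0.
Proof.
induction n as [|n IH]; [rewrite Rmult_0_l; apply sin_0|].
rewrite S_INR, Rmult_plus_distr_r, Rmult_1_l, sin_plus, sin_2PI, IH; ring.
Qed.

(** The difference of the two sides is the integral of the derivative of a
    function of period [2 PI]. *)
Lemma RInt_wave_rec (x : R) (n : nat) :
  x * RInt (wave x (INR n - 1)) 0 (2 * PI) = INR n * RInt (wave x (INR n)) 0 (2 * PI).
Proof.
set (F := fun t => exp (x * cos t) * sin (x * sin t - INR n * t)).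
assert (HF : forall t, is_derive F t (x * wave x (INR n - 1) t - INR n * wave x (INR n) t)).
{ intros t; unfold F, wave; auto_derive; trivial.
  replace (x * sin t - (INR n - 1) * t) with ((x * sin t - INR n * t) + t) by ring.
  rewrite (cos_plus (x * sin t - INR n * t) t); unfold Rminus; ring. }
assert (HI : is_RInt (fun t => x * wave x (INR n - 1) t - INR n * wave x (INR n) t) 0 (2 * PI)
  (F (2 * PI) - F 0)).
{ apply (is_RInt_derive (V := R_CompleteNormedModule) F); intros t _; [apply HF|].
  apply (ex_derive_continuous (K := R_AbsRing) (V := R_NormedModule)).
  unfold wave; auto_derive; trivial. }
replace (F (2 * PI) - F 0) with 0 in HI.
2: { unfold F; rewrite sin_2PI, sin_0, !Rmult_0_r, Rminus_0_r, sin_0.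
  unfold Rminus; rewrite Rplus_0_l, sin_neg, sin_2PI_nat; ring. }
assert (Hc : is_RInt (fun t => x * wave x (INR n - 1) t - INR n * wave x (INR n) t) 0 (2 * PI)
  (x * RInt (wave x (INR n - 1)) 0 (2 * PI) - INR n * RInt (wave x (INR n)) 0 (2 * PI))).
{ apply (is_RInt_minus (V := R_NormedModule) (fun t => x * wave x (INR n - 1) t) (fun t => INR n * wave x (INR n) t));
    apply (is_RInt_scal (V := R_NormedModule)), (RInt_correct (V := R_CompleteNormedModule)), ex_RInt_wave. }
apply (is_RInt_unique (V := R_CompleteNormedModule)) in Hc.
apply Rminus_diag_uniq; rewrite <- Hc.
apply (is_RInt_unique (V := R_CompleteNormedModule)), HI.
Qed.

(** The derivative in [x] is the integral of [wave x (- 1)], which vanishes by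
    [RInt_wave_rec] at [n = 0]. *)
Lemma RInt_wave_0 (x : R) : RInt (wave x 0) 0 (2 * PI) = 2 * PI.
Proof.
assert (Hd : forall x : R, is_derive (fun x => RInt (wave x 0) 0 (2 * PI) + - (2 * PI)) x 0).
{ clear x; intros x.
  assert (HD : forall u t : R, is_derive (fun z => wave z 0 t) u (wave u (-1) t)).
  { intros u t; unfold wave; auto_derive; trivial.
    replace (u * sin t - (-1) * t) with ((u * sin t - 0 * t) + t) by ring.
    rewrite (cos_plus (u * sin t - 0 * t) t); unfold Rminus; ring. }
  assert (HI : RInt (fun t => Derive (fun u => wave u 0 t) x) 0 (2 * PI) = 0).
  { rewrite (RInt_ext _ (wave x (INR 0 - 1))).
    2: { intros t _; simpl INR; rewrite Rminus_0_l; apply is_derive_unique, HD. }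
    destruct (Req_dec x 0) as [->|Hx].
    - apply (is_RInt_unique (V := R_CompleteNormedModule)).
      apply (is_RInt_ext cos).
      { intros t _; unfold wave; simpl INR; rewrite !Rmult_0_l, exp_0, Rmult_1_l.
        replace (0 - (0 - 1) * t) with t by ring; reflexivity. }
      replace 0 with (sin (2 * PI) - sin 0) at 2 by (rewrite sin_2PI, sin_0; ring).
      apply (is_RInt_derive (V := R_CompleteNormedModule) sin cos); intros t _.
      + auto_derive; trivial; ring.
      + apply continuous_cos.
    - apply Rmult_eq_reg_l with x; [|exact Hx].
      rewrite RInt_wave_rec; simpl INR; ring. }
  assert (HR : is_derive (fun x => RInt (wave x 0) 0 (2 * PI)) x
    (RInt (fun t => Derive (fun u => wave u 0 t) x) 0 (2 * PI))).
  2: { rewrite HI in HR; match goal with |- is_derive ?f _ _ =>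
      cut (is_derive f x (0 + 0)); [rewrite Rplus_0_r; trivial|] end.
    apply (is_derive_Rplus (fun x => RInt (wave x 0) 0 (2 * PI)) (fun _ => - (2 * PI))); [exact HR|].
    apply (@is_derive_const R_AbsRing R_NormedModule). }
  apply (is_derive_RInt_param (fun x => wave x 0)).
  - exists (mkposreal 1 Rlt_0_1); intros y _ t _; eexists; apply HD.
  - intros t _; apply (continuity_2d_pt_ext (fun u v => wave u (-1) v)).
    { intros u v; symmetry; apply is_derive_unique, HD. }
    unfold wave; apply continuity_2d_pt_mult.
    + apply continuity_1d_2d_pt_comp; [apply derivable_continuous_pt, derivable_pt_exp|].
      apply continuity_2d_pt_mult; [apply continuity_2d_pt_id1|].
      apply (continuity_1d_2d_pt_comp cos); [apply continuity_cos|apply continuity_2d_pt_id2].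
    + apply continuity_1d_2d_pt_comp; [apply continuity_cos|].
      apply continuity_2d_pt_minus; apply continuity_2d_pt_mult;
        try apply continuity_2d_pt_id1; try apply continuity_2d_pt_id2; try apply continuity_2d_pt_const.
      apply (continuity_1d_2d_pt_comp sin); [apply continuity_sin|apply continuity_2d_pt_id2].
  - exists (mkposreal 1 Rlt_0_1); intros y _; apply ex_RInt_wave. }
assert (H := derive_zero_const (fun x => RInt (wave x 0) 0 (2 * PI) + - (2 * PI)) Hd).
cut (RInt (wave x 0) 0 (2 * PI) + - (2 * PI) = 0); [lra|]; apply H.
rewrite (RInt_ext _ (fun _ => 1)).
- rewrite RInt_const; unfold scal; simpl; unfold mult; simpl; ring.
- intros t _; unfold wave; rewrite !Rmult_0_l, exp_0, Rminus_0_r, cos_0; apply Rmult_1_r.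
Qed.

Lemma RInt_wave (x : R) (n : nat) :
  RInt (wave x (INR n)) 0 (2 * PI) = 2 * PI * divpow n x.
Proof.
induction n as [|n IH].
- simpl INR; rewrite RInt_wave_0; unfold divpow; simpl; field.
- assert (H := RInt_wave_rec x (S n)).
  replace (INR (S n) - 1) with (INR n) in H by (rewrite S_INR; ring); rewrite IH in H.
  assert (Hn : INR (S n) <> 0) by (apply not_0_INR; lia).
  apply Rmult_eq_reg_l with (INR (S n)); [|exact Hn]; rewrite <- H.
  unfold divpow; rewrite fact_simpl, mult_INR; simpl pow; field.
  split; [apply INR_fact_neq_0|exact Hn].
Qed.

Lemma is_RInt_sum (c : nat -> R) (g : nat -> R -> R) (I : nat -> R) (a b : R) (n : nat) :
  (forall i, is_RInt (g i) a b (I i)) ->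
  is_RInt (fun t => sum_f_R0 (fun i => c i * g i t) n) a b (sum_f_R0 (fun i => c i * I i) n).
Proof.
intros H; assert (Hs : forall i, is_RInt (fun t => c i * g i t) a b (c i * I i)).
{ intros i; apply (is_RInt_scal (V := R_NormedModule)), H. }
induction n as [|n IH]; [apply Hs|].
apply (is_RInt_plus (V := R_NormedModule) (fun t => sum_f_R0 (fun i => c i * g i t) n)); [exact IH|apply Hs].
Qed.

(** The rising factorial [(1 - y) (2 - y) ... (n - 1 - y)], expanded; the factors
    appear in [rising_S]. *)
Definition rising (n : nat) (y : C) : C :=
  Csum (fun i => RtoC ((-1) ^ i * INR (stirling_cycle n (S i))) * y ^ i)%C n.

Lemma rising_1 (y : C) : rising 1 y = 1.
Proof.
unfold rising; simpl; rewrite !stirling_cycle_SS, !stirling_cycle_0S, stirling_cycle_00.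
simpl; rewrite !RtoC_mult; ring.
Qed.

Lemma rising_S (n : nat) (y : C) :
  rising (S (S n)) y = (rising (S n) y * (RtoC (INR (S n)) - y))%C.
Proof.
assert (H : Csum (fun i => RtoC ((-1) ^ i * INR (stirling_cycle (S n) i)) * y ^ i)%C (S n)
  = (- y * rising (S n) y)%C).
{ unfold rising; rewrite Csum_first, (Csum_last _ n), stirling_cycle_S0.
  rewrite (stirling_cycle_gt (S n) (S (S n))) by lia; simpl (INR 0).
  rewrite (Csum_eq (fun i => RtoC ((-1) ^ S i * INR (stirling_cycle (S n) (S i))) * y ^ S i)%C
    (fun i => (- y) * (RtoC ((-1) ^ i * INR (stirling_cycle (S n) (S i))) * y ^ i))%C).
  - rewrite Csum_scal, !Rmult_0_r; ring.
  - intros i _; rewrite Cpow_S; simpl pow; rewrite !RtoC_mult; ring. }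
transitivity (RtoC (INR (S n)) * rising (S n) y + - y * rising (S n) y)%C; [|ring].
rewrite <- H; unfold rising; rewrite Csum_last, (stirling_cycle_gt (S (S n)) (S (S (S n)))) by lia.
simpl (INR 0); rewrite Rmult_0_r, <- Csum_scal, <- Csum_plus.
rewrite Cmult_0_l, Cplus_0_r; apply Csum_eq; intros i _.
rewrite stirling_cycle_SS, plus_INR, mult_INR.
rewrite !RtoC_mult, RtoC_plus, RtoC_mult; ring.
Qed.

Definition polar (r t : R) : C := (r * cos t, r * sin t).

Lemma polar_pow (r t : R) (n : nat) : (polar r t ^ n)%C = polar (r ^ n) (INR n * t).
Proof.
induction n as [|n IH].
- simpl; unfold polar; rewrite Rmult_0_l, cos_0, sin_0; apply injective_projections; simpl; ring.
- rewrite Cpow_S, IH, S_INR, Rmult_plus_distr_r, Rmult_1_l; unfold polar.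
  rewrite cos_plus, sin_plus; apply injective_projections; simpl; ring.
Qed.

Lemma Re_Csum (f : nat -> C) (n : nat) : Re (Csum f n) = sum_f_R0 (fun i => Re (f i)) n.
Proof. induction n as [|n IH]; [reflexivity|]; rewrite sum_last, <- IH; reflexivity. Qed.

(** Cauchy's estimate: [coef n q] is the coefficient of [y ^ n] in
    [rising n y * exp (q y)], and [M] bounds this function on the circle of
    radius [r]. *)
Lemma coef_cauchy (n : nat) (q r M : R) : 0 < r ->
  (forall t, Cmod (rising n (polar r t)) * exp (q * r * cos t) <= M) ->
  Rabs (coef n q) * r ^ n <= M.
Proof.
intros Hr HM.
set (c := fun i => (-1) ^ i * INR (stirling_cycle n (S i)) * r ^ i).
set (h := fun t => sum_f_R0 (fun i => c i * wave (q * r) (INR (n - i)) t) n).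
assert (HI : is_RInt h 0 (2 * PI) (2 * PI * (coef n q * r ^ n))).
{ replace (2 * PI * (coef n q * r ^ n)) with
    (sum_f_R0 (fun i => c i * (2 * PI * divpow (n - i) (q * r))) n).
  - apply is_RInt_sum; intros i; rewrite <- RInt_wave.
    apply (RInt_correct (V := R_CompleteNormedModule)), ex_RInt_wave.
  - rewrite (Rmult_comm (coef n q)), <- Rmult_assoc; unfold coef; rewrite <- sum_scal.
    apply sum_eq; intros i Hi; unfold c, divpow; rewrite Rpow_mult_distr.
    replace (r ^ n) with (r ^ i * r ^ (n - i)) by (rewrite <- pow_add; f_equal; lia).
    unfold Rdiv; ring. }
assert (Hh : forall t, Rabs (h t) <= M).
{ intros t; eapply Rle_trans; [|apply (HM t)].
  set (ph := q * r * sin t - INR n * t).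
  replace (h t) with (Re (rising n (polar r t) * polar (exp (q * r * cos t)) ph)%C).
  - eapply Rle_trans; [apply re_le_Cmod|]; rewrite Cmod_mult; apply Rmult_le_compat_l; [apply Cmod_ge_0|].
    right; apply Rsqr_inj; [apply Cmod_ge_0|left; apply exp_pos|].
    rewrite !Rsqr_pow2, Cmod2_alt; unfold polar, Re, Im; simpl.
    assert (Hsc := sin2_cos2 ph); unfold Rsqr in Hsc; nra.
  - unfold rising; rewrite Cmult_comm, <- Csum_scal, Re_Csum; unfold h.
    apply sum_eq; intros i Hi; rewrite polar_pow; unfold c, wave.
    replace (q * r * sin t - INR (n - i) * t) with (ph + INR i * t)
      by (unfold ph; rewrite minus_INR by exact Hi; ring).
    rewrite cos_plus; unfold polar, Re; simpl; ring. }
assert (Hpi := PI_RGT_0).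
assert (Hb := abs_RInt_le_const h 0 (2 * PI) M ltac:(lra) (ex_intro _ _ HI) (fun t _ => Hh t)).
rewrite (is_RInt_unique (V := R_CompleteNormedModule) _ _ _ _ HI) in Hb.
rewrite !Rabs_mult, (Rabs_pos_eq (r ^ n)) in Hb by (apply pow_le; lra).
rewrite (Rabs_pos_eq 2), (Rabs_pos_eq PI), Rminus_0_r in Hb by lra.
apply Rmult_le_reg_l with (2 * PI); lra.
Qed.

(** * The maximum on the circle *)

Fixpoint sum1 (f : nat -> R) (m : nat) : R :=
  match m with O => 0 | S k => sum1 f k + f (S k) end.

Lemma sum1_plus_scal (f g : nat -> R) (c : R) (m : nat) :
  sum1 (fun j => f j + c * g j) m = sum1 f m + c * sum1 g m.
Proof. induction m as [|m IH]; simpl; [|rewrite IH]; ring. Qed.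

(** The squared distance from [j] to the points of modulus [r] whose argument
    has cosine [t0]. *)
Definition dist2 (r t0 : R) (j : nat) : R := INR j ^ 2 - 2 * INR j * r * t0 + r ^ 2.

(** The logarithm of the modulus is a concave function of [cos t], hence lies
    below its tangent at [t0]. *)
Lemma Cmod_factor (r t0 t : R) (j : nat) : 0 < dist2 r t0 j ->
  Cmod (RtoC (INR j) - polar r t) <=
  exp (/ 2 * ln (dist2 r t0 j) + - ((cos t - t0) * r) * (INR j / dist2 r t0 j)).
Proof.
intros HD; set (D := dist2 r t0 j) in *.
set (u := - (2 * ((cos t - t0) * r)) * (INR j / D)).
apply Rsqr_incr_0; [|apply Cmod_ge_0|left; apply exp_pos].
rewrite !Rsqr_pow2, Cmod2_alt.
replace (exp (/ 2 * ln D + - ((cos t - t0) * r) * (INR j / D)) ^ 2) with (D * exp u).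
- assert (Hu := exp_ineq1_le u).
  apply Rle_trans with (D * (1 + u)); [|apply Rmult_le_compat_l; lra].
  right; replace (D * (1 + u)) with (D - 2 * ((cos t - t0) * r) * INR j) by (unfold u; field; lra).
  unfold D, dist2, polar, Re, Im; simpl.
  assert (Hsc := sin2_cos2 t); unfold Rsqr in Hsc; nra.
- rewrite <- (exp_ln D) at 1 by exact HD.
  simpl pow; rewrite Rmult_1_r, <- !exp_plus; f_equal; unfold u; field; lra.
Qed.

Lemma Cmod_rising (r t0 t : R) (m : nat) : (forall j, 0 < dist2 r t0 j) ->
  Cmod (rising (S m) (polar r t)) <=
  exp (sum1 (fun j => / 2 * ln (dist2 r t0 j)) m
       + - ((cos t - t0) * r) * sum1 (fun j => INR j / dist2 r t0 j) m).
Proof.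
intros HD; rewrite <- sum1_plus_scal; induction m as [|m IH].
- rewrite rising_1, Cmod_1; simpl; rewrite exp_0; lra.
- rewrite rising_S, Cmod_mult; cbn [sum1]; rewrite exp_plus.
  apply Rmult_le_compat; try apply Cmod_ge_0; [exact IH|].
  apply Cmod_factor, HD.
Qed.

(** The difference between [q] and the second sum, times [r], is the slope at
    [t0] of the logarithm of the modulus as a function of [cos t]; it is small
    when [t0] belongs to the saddle point. *)
Lemma coef_bound (q r t0 : R) (m : nat) : 0 < r -> -1 <= t0 <= 1 ->
  (forall j, 0 < dist2 r t0 j) ->
  Rabs (coef (S m) q) * r ^ S m <=
  exp (sum1 (fun j => / 2 * ln (dist2 r t0 j)) m + q * r * t0
       + 2 * r * Rabs (q - sum1 (fun j => INR j / dist2 r t0 j) m)).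
Proof.
intros Hr Ht HD; apply coef_cauchy; [exact Hr|]; intros t.
eapply Rle_trans; [apply Rmult_le_compat_r; [left; apply exp_pos|apply (Cmod_rising r t0 t m HD)]|].
rewrite <- exp_plus; set (T := sum1 (fun j => INR j / dist2 r t0 j) m).
set (E := sum1 _ m).
match goal with |- exp ?a <= exp ?b => cut (a <= b) end.
{ intros [H|H]; [left; apply exp_increasing, H|rewrite H; lra]. }
assert (Hc := COS_bound t).
assert (H : (cos t - t0) * (q - T) <= 2 * Rabs (q - T)).
{ eapply Rle_trans; [apply Rle_abs|]; rewrite Rabs_mult; apply Rmult_le_compat_r; [apply Rabs_pos|].
  apply Rabs_le; lra. }
apply Rmult_le_compat_l with (r := r) in H; [|lra]; lra.
Qed.


(** * The saddle point *)

(** The mean value theorem on each of the intervals of length [/ INR (S m)],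
    with the uniform continuity of [g].  The omitted last point contributes
    [g 1 / INR (S m)]. *)
Lemma riemann_sum1 (g G : R -> R) :
  (forall x, 0 <= x <= 1 -> continuity_pt g x) ->
  (forall x, 0 <= x <= 1 -> is_derive G x (g x)) ->
  is_lim_seq (fun m => / INR (S m) * sum1 (fun j => g (INR j / INR (S m))) m) (G 1 - G 0).
Proof.
intros Hc HG.
assert (Hn : forall m, 0 < INR (S m)) by (intros m; apply lt_0_INR; lia).
assert (L0 : is_lim_seq (fun m => / INR (S m)) 0).
{ apply (is_lim_seq_inv (fun m => INR (S m)) p_infty); [|discriminate].
  apply (is_lim_seq_incr_1 INR), is_lim_seq_INR. }
assert (L : is_lim_seq (fun m => G 1 - G 0 -
   / INR (S m) * sum1 (fun j => g (INR j / INR (S m))) (S m)) 0).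
{ apply is_lim_seq_spec; intros eps.
  destruct (@Heine_cor2 g 0 1 Hc (mkposreal (eps / 2) (is_pos_div_2 eps))) as [d Hd]; simpl in Hd.
  apply is_lim_seq_spec in L0; destruct (L0 d) as [N HN]; exists N; intros m Hm.
  specialize (HN m Hm); rewrite Rminus_0_r in HN |- *; specialize (Hn m).
  set (n := INR (S m)) in *.
  rewrite Rabs_pos_eq in HN by (left; apply Rinv_0_lt_compat, Hn).
  assert (H : forall k, (k <= S m)%nat ->
    Rabs (G (INR k / n) - G 0 - / n * sum1 (fun j => g (INR j / n)) k) <= INR k / n * (eps / 2)).
  { induction k as [|k IH]; intros Hk.
    - simpl; unfold Rdiv; rewrite !Rmult_0_l, Rmult_0_r.
      replace (G 0 - G 0 - 0) with 0 by ring; rewrite Rabs_R0; lra.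
    - specialize (IH ltac:(lia)); cbn [sum1].
      assert (Hk' : INR (S k) <= n) by (apply le_INR, Hk); rewrite S_INR in Hk'.
      assert (Hk0 := pos_INR k).
      assert (Hu : 0 <= INR k / n) by (apply Rmult_le_pos; [lra|left; apply Rinv_0_lt_compat, Hn]).
      assert (Hstep : INR (S k) / n = INR k / n + / n) by (rewrite S_INR; field; lra).
      assert (Hv : INR (S k) / n <= 1).
      { apply Rmult_le_reg_r with n; [exact Hn|]; unfold Rdiv.
        rewrite Rmult_assoc, Rinv_l, S_INR by lra; lra. }
      assert (Hin := Rinv_0_lt_compat n Hn).
      destruct (MVT_cmp G g (INR k / n) (INR (S k) / n)) as [c [Hcc E]]; [lra| |].
      { intros x Hx; apply HG; lra. }
      assert (Hg : Rabs (g c - g (INR (S k) / n)) < eps / 2).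
      { apply Hd; [lra|lra|]; apply Rabs_def1; lra. }
      replace (G (INR (S k) / n) - G 0 - / n * (sum1 (fun j => g (INR j / n)) k + g (INR (S k) / n)))
        with ((G (INR k / n) - G 0 - / n * sum1 (fun j => g (INR j / n)) k)
          + / n * (g c - g (INR (S k) / n))).
      2: { replace (G (INR (S k) / n)) with (G (INR k / n) + g c * (INR (S k) / n - INR k / n)) by lra.
        rewrite Hstep; ring. }
      eapply Rle_trans; [apply Rabs_triang|]; rewrite Rabs_mult, (Rabs_pos_eq (/ n)) by lra.
      apply Rlt_le in Hg; apply Rmult_le_compat_l with (r := / n) in Hg; [|lra].
      replace (INR (S k) / n * (eps / 2)) with (INR k / n * (eps / 2) + / n * (eps / 2))
        by (rewrite Hstep; ring); lra. }
  specialize (H (S m) (le_n _)); fold n in H.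
  replace (n / n) with 1 in H by (field; lra).
  assert (He := cond_pos eps); lra. }
apply (is_lim_seq_ext (fun m => (G 1 - G 0) - (G 1 - G 0 -
   / INR (S m) * sum1 (fun j => g (INR j / INR (S m))) (S m)) - / INR (S m) * g 1)).
{ intros m; cbn [sum1]; specialize (Hn m).
  replace (INR (S m) / INR (S m)) with 1 by (field; lra); ring. }
replace (Finite (G 1 - G 0)) with (Finite ((G 1 - G 0) - 0 - 0 * g 1)) by (f_equal; ring).
apply is_lim_seq_minus'; [apply is_lim_seq_minus'; [apply is_lim_seq_const|exact L]|].
apply is_lim_seq_mult'; [exact L0|apply is_lim_seq_const].
Qed.

Lemma sum1_eq (f g : nat -> R) (m : nat) :
  (forall j, f j = g j) -> sum1 f m = sum1 g m.
Proof. intros H; induction m as [|m IH]; simpl; [|rewrite IH, H]; reflexivity. Qed.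

(** The left-hand side is the angle under which the segment from 0 to 1 is seen
    from the saddle point [Y]; the equality is the imaginary part of the saddle
    equation [log (Y / (Y - 1)) + q = 1 / Y]. *)
Lemma saddle_angle (y : R) : 0 < y < PI ->
  let A := one_sub_cot y in
  atan ((A ^ 2 + y ^ 2 - A) / y) + atan (A / y) = y.
Proof.
intros Hy A; assert (HA : 0 < A) by (apply one_sub_cot_pos, Hy).
assert (Hs : 0 < sin y) by (apply sin_gt_0; lra).
set (al := atan (A / y)).
assert (Hal : 0 < al).
{ unfold al; rewrite <- atan_0; apply atan_increasing, Rdiv_lt_0_compat; lra. }
assert (Hal2 := atan_bound (A / y)); fold al in Hal2.
set (c := 1 / sqrt (1 + Rsqr (A / y))).
assert (Hc : 0 < c).
{ apply Rdiv_lt_0_compat; [lra|]; apply sqrt_lt_R0; assert (H := Rle_0_sqr (A / y)); lra. }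
assert (Hcos : cos al = c) by apply cos_atan.
assert (Hsin : sin al = c * (A / y)).
{ unfold al; rewrite sin_atan; unfold c, Rdiv; ring. }
assert (Hys : A * sin y = sin y - y * cos y) by (unfold A, one_sub_cot; field; lra).
assert (HC : cos (y - al) = c * (sin y / y)).
{ rewrite cos_minus, Hcos, Hsin.
  replace (cos y * c + sin y * (c * (A / y))) with (c * (cos y + (A * sin y) / y)) by (field; lra).
  rewrite Hys; field; lra. }
assert (HS : sin (y - al) = c * (sin y - cos y * (A / y))).
{ rewrite sin_minus, Hcos, Hsin; ring. }
assert (HCpos : 0 < cos (y - al)).
{ rewrite HC; apply Rmult_lt_0_compat; [exact Hc|apply Rdiv_lt_0_compat; lra]. }
assert (Hlt : y - al < PI / 2).
{ apply Rnot_le_lt; intros H; assert (cos (y - al) <= 0); [|lra].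
  apply cos_le_0; lra. }
replace ((A ^ 2 + y ^ 2 - A) / y) with (tan (y - al)).
{ rewrite atan_tan; lra. }
unfold tan; rewrite HC, HS.
replace (c * (sin y - cos y * (A / y)) / (c * (sin y / y))) with ((y * sin y - A * cos y) / sin y)
  by (field; lra).
apply Rmult_eq_reg_r with (sin y * y); [|apply Rmult_integral_contrapositive; lra].
replace ((y * sin y - A * cos y) / sin y * (sin y * y)) with (y ^ 2 * sin y - A * (y * cos y)) by (field; lra).
replace (y * cos y) with (sin y - A * sin y) by lra; field; lra.
Qed.

(** The saddle point of [rising n * exp (q _)] is near [n (a + i b)] with
    [1 / (a + i b) = one_sub_cot y - i y].  After division by [n], the sums in
    [coef_bound] at this point are Riemann sums: the second tends to [q], which
    is the saddle condition, and the exponent to [ln (y / sin y)]. *)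
Lemma ex_series_q_pos (y l : R) : 0 < y < PI -> y / sin y < l ->
  ex_series (fun n => coef n (critical_q y) * (/ l) ^ n).
Proof.
intros Hy Hl.
set (q := critical_q y); set (A := one_sub_cot y); set (ka := y / sin y) in *.
assert (Hs : 0 < sin y) by (apply sin_gt_0; lra).
assert (HA : 0 < A) by (apply one_sub_cot_pos, Hy).
assert (Hka : 1 < ka) by (apply div_sin_gt_1, Hy).
set (m2 := A ^ 2 + y ^ 2).
assert (Hm2 : 0 < m2) by (unfold m2; nra).
set (a := A / m2); set (b := y / m2); set (rho := sqrt (/ m2)).
assert (Hb : 0 < b) by (apply Rdiv_lt_0_compat; lra).
assert (Ha : 0 < a) by (apply Rdiv_lt_0_compat; lra).
assert (Hrho : 0 < rho) by (apply sqrt_lt_R0, Rinv_0_lt_compat, Hm2).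
assert (Hrho2 : rho * rho = / m2) by (apply sqrt_sqrt; left; apply Rinv_0_lt_compat, Hm2).
assert (Hab : a ^ 2 + b ^ 2 = / m2) by (unfold a, b, m2 in *; field; lra).
set (d := fun x : R => (x - a) ^ 2 + b ^ 2).
assert (Hd : forall x, 0 < d x) by (intros x; unfold d; assert (0 <= (x - a) ^ 2) by apply pow2_ge_0; nra).
(* Antiderivatives of the two summands, [/ 2 * ln (d x)] and [x / d x]. *)
set (G1 := fun x => (x - a) * (/ 2 * ln (d x)) - x + b * atan ((x - a) / b)).
set (G2 := fun x => / 2 * ln (d x) + a / b * atan ((x - a) / b)).
assert (HG1 : forall x, is_derive G1 x (/ 2 * ln (d x))).
{ intros x; specialize (Hd x); unfold G1, d in *.
  auto_derive; [simpl in *; repeat split; trivial; lra|].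
  change (x + - a) with (x - a); change ((x - a) * ((x - a) * 1) + b * (b * 1)) with ((x - a) ^ 2 + b ^ 2).
  generalize (ln ((x - a) ^ 2 + b ^ 2)); intros; field; repeat split; nra. }
assert (HG2 : forall x, is_derive G2 x (x / d x)).
{ intros x; specialize (Hd x); unfold G2, d in *.
  auto_derive; [simpl in *; repeat split; trivial; lra|].
  change (x + - a) with (x - a); change ((x - a) * ((x - a) * 1) + b * (b * 1)) with ((x - a) ^ 2 + b ^ 2).
  generalize (ln ((x - a) ^ 2 + b ^ 2)); intros; field; repeat split; nra. }
(* [rho] is the modulus of [a + i b], and [ka * rho] its distance from 1. *)
assert (Hd1 : d 1 = ka ^ 2 * / m2).
{ assert (Hka2 : ka ^ 2 = (A - 1) ^ 2 + y ^ 2).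
  { unfold ka, A, one_sub_cot.
    replace ((y / sin y) ^ 2) with (y ^ 2 * (sin y ^ 2 + cos y ^ 2) / sin y ^ 2).
    - field; lra.
    - replace (sin y ^ 2 + cos y ^ 2) with 1 by (rewrite <- (sin2_cos2 y); unfold Rsqr; ring).
      field; lra. }
  rewrite Hka2; unfold d; replace ((1 - a) ^ 2 + b ^ 2) with (1 - 2 * a + (a ^ 2 + b ^ 2)) by ring.
  rewrite Hab; unfold a, m2 in *; field; lra. }
assert (Hd0 : d 0 = / m2) by (unfold d; rewrite <- Hab; ring).
assert (Hln0 : ln (d 0) = 2 * ln rho).
{ rewrite Hd0, <- Hrho2, ln_mult by lra; ring. }
assert (Hln1 : / 2 * ln (d 1) = ln ka + ln rho).
{ rewrite Hd1, <- Hrho2; replace (ka ^ 2 * (rho * rho)) with ((ka * rho) * (ka * rho)) by ring.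
  assert (0 < ka * rho) by nra; rewrite !ln_mult by lra; field. }
assert (Hat : atan ((1 - a) / b) + atan (a / b) = y).
{ transitivity (atan ((A ^ 2 + y ^ 2 - A) / y) + atan (A / y)); [|exact (saddle_angle y Hy)].
  f_equal; f_equal; unfold a, b, m2 in *; field; lra. }
assert (Hat0 : atan ((0 - a) / b) = - atan (a / b)).
{ rewrite <- atan_opp; f_equal; field; lra. }
assert (Hq2 : G2 1 - G2 0 = q).
{ unfold G2; rewrite Hat0, Hln0, Hln1.
  replace (atan ((1 - a) / b)) with (y - atan (a / b)) by lra.
  unfold q, critical_q; fold A ka; replace (a / b) with (A / y) by (unfold a, b; field; lra).
  field; lra. }
assert (HI1 : G1 1 - G1 0 + q * a - ln rho = ln ka).
{ unfold G1; rewrite Hat0, Hln0, Hln1.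
  replace (atan ((1 - a) / b)) with (y - atan (a / b)) by lra.
  unfold q, critical_q; fold A ka.
  assert (Hab2 : b * y + a * A = 1) by (unfold a, b, m2 in *; field; lra).
  transitivity (ln ka - 1 + (b * y + a * A)); [field|rewrite Hab2; ring]. }
assert (L1 := riemann_sum1 (fun x => / 2 * ln (d x)) G1).
assert (L2 := riemann_sum1 (fun x => x / d x) G2).
assert (Hc1 : forall x, 0 <= x <= 1 -> continuity_pt (fun x => / 2 * ln (d x)) x).
{ intros x _; apply continuity_pt_filterlim.
  apply (ex_derive_continuous (K := R_AbsRing) (V := R_NormedModule) (fun x => / 2 * ln (d x))).
  specialize (Hd x); unfold d in *; auto_derive; simpl in *; lra. }
assert (Hc2 : forall x, 0 <= x <= 1 -> continuity_pt (fun x => x / d x) x).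
{ intros x _; apply continuity_pt_filterlim.
  apply (ex_derive_continuous (K := R_AbsRing) (V := R_NormedModule) (fun x => x / d x)).
  specialize (Hd x); unfold d in *; auto_derive; simpl in *; lra. }
specialize (L1 Hc1 (fun x _ => HG1 x)); specialize (L2 Hc2 (fun x _ => HG2 x)).
rewrite Hq2 in L2.
set (u1 := fun m => / INR (S m) * sum1 (fun j => / 2 * ln (d (INR j / INR (S m)))) m) in L1.
set (u2 := fun m => / INR (S m) * sum1 (fun j => INR j / INR (S m) / d (INR j / INR (S m))) m) in L2.
(* [v m] is the exponent of [coef_bound], relative to the power of [n * rho],
   divided by [n]. *)
set (v := fun m => u1 m + (q * a - ln rho) + 2 * rho * Rabs (q - u2 m)).
assert (Lv : is_lim_seq v (ln ka)).
{ replace (Finite (ln ka)) with (Finite ((G1 1 - G1 0) + (q * a - ln rho) + 2 * rho * Rabs (q - q))).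
  - apply is_lim_seq_plus'; [apply is_lim_seq_plus'; [exact L1|apply is_lim_seq_const]|].
    apply is_lim_seq_mult'; [apply is_lim_seq_const|].
    apply (is_lim_seq_abs (fun m => q - u2 m) (q - q)).
    apply is_lim_seq_minus'; [apply is_lim_seq_const|exact L2].
  - f_equal; rewrite Rminus_diag, Rabs_R0; lra. }
assert (Hbound : forall m, Rabs (coef (S m) q) <= exp (INR (S m) * v m)).
{ intros m; assert (Hn : 0 < INR (S m)) by (apply lt_0_INR; lia).
  set (n := INR (S m)) in *.
  assert (Hn1 : 1 <= n) by (unfold n; rewrite S_INR; assert (H := pos_INR m); lra).
  assert (Hr : 0 < n * rho) by nra.
  assert (Ht : -1 <= a / rho <= 1).
  { assert (0 < a / rho) by (apply Rdiv_lt_0_compat; lra); split; [lra|].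
    apply Rmult_le_reg_r with rho; [exact Hrho|].
    replace (a / rho * rho) with a by (field; lra).
    apply Rsqr_incr_0; unfold Rsqr; [|lra|lra]; rewrite Rmult_1_l, Hrho2, <- Hab; nra. }
  assert (HD : forall j, dist2 (n * rho) (a / rho) j = n * n * d (INR j / n)).
  { intros j; unfold dist2, d.
    replace (n * n * ((INR j / n - a) ^ 2 + b ^ 2)) with
      (INR j ^ 2 - 2 * INR j * n * a + n ^ 2 * (a ^ 2 + b ^ 2)) by (field; lra).
    rewrite Hab, <- Hrho2; field; lra. }
  assert (HB := coef_bound q (n * rho) (a / rho) m Hr Ht).
  assert (HDp : forall j, 0 < dist2 (n * rho) (a / rho) j).
  { intros j; rewrite HD; specialize (Hd (INR j / n)); apply Rmult_lt_0_compat; [nra|exact Hd]. }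
  specialize (HB HDp).
  rewrite (sum1_eq _ (fun j => / 2 * ln (d (INR j / n)) + ln n * 1)) in HB.
  2: { intros j; rewrite HD, ln_mult, ln_mult; [field|lra|lra|nra|apply Hd]. }
  rewrite sum1_plus_scal in HB.
  rewrite (sum1_eq (fun j => INR j / dist2 (n * rho) (a / rho) j)
    (fun j => 0 + / n * (INR j / n / d (INR j / n)))) in HB.
  2: { intros j; rewrite HD; specialize (Hd (INR j / n)); field; lra. }
  rewrite sum1_plus_scal in HB.
  replace (sum1 (fun _ => 0) m) with 0 in HB by (clear; induction m as [|m IH]; simpl; lra).
  replace (sum1 (fun _ => 1) m) with (INR m) in HB
    by (clear; induction m as [|m IH]; [reflexivity|rewrite S_INR, IH; reflexivity]).
  rewrite Rplus_0_l in HB.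
  change (/ n * sum1 (fun j => INR j / n / d (INR j / n)) m) with (u2 m) in HB.
  assert (Hpow : (n * rho) ^ S m = exp (n * (ln n + ln rho))).
  { rewrite <- ln_mult by lra; unfold n at 2.
    rewrite <- Rpower_pow by exact Hr; reflexivity. }
  rewrite Hpow in HB.
  assert (Hln : 0 <= ln n).
  { rewrite <- ln_1; destruct (Req_dec n 1) as [->|]; [lra|left; apply ln_increasing; lra]. }
  apply Rmult_le_reg_r with (exp (n * (ln n + ln rho))); [apply exp_pos|].
  eapply Rle_trans; [exact HB|]; rewrite <- exp_plus.
  match goal with |- exp ?s <= exp ?t => cut (s <= t) end.
  { intros [H|H]; [left; apply exp_increasing, H|rewrite H; lra]. }
  unfold v, u1; fold n.
  set (S1 := sum1 (fun j => / 2 * ln (d (INR j / n))) m).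
  replace (n * (/ n * S1 + (q * a - ln rho) + 2 * rho * Rabs (q - u2 m)) + n * (ln n + ln rho))
    with (S1 + n * ln n + q * (n * a) + 2 * (n * rho) * Rabs (q - u2 m)) by (field; lra).
  replace (q * (n * rho) * (a / rho)) with (q * (n * a)) by (field; lra).
  assert (ln n * INR m <= n * ln n); [|lra].
  rewrite (Rmult_comm n (ln n)); apply Rmult_le_compat_l; [exact Hln|].
  unfold n; rewrite S_INR; lra. }
assert (Hlk : ln ka < ln l) by (apply ln_increasing; lra).
(* Half of the gap is left for a geometric majorant. *)
set (de := (ln l - ln ka) / 2).
assert (Hde : 0 < de) by (unfold de; lra).
apply is_lim_seq_spec in Lv; destruct (Lv (mkposreal de Hde)) as [N HN]; simpl in HN.
apply (ex_series_incr_n _ (S N)).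
apply (ex_series_le (K := R_AbsRing) (V := R_CompleteNormedModule) _ (fun k => exp (- de) ^ (S N + k))).
- intros k; change (Rabs (coef (S N + k) q * (/ l) ^ (S N + k)) <= exp (- de) ^ (S N + k)).
  simpl Nat.add; specialize (HN (N + k)%nat ltac:(lia)); specialize (Hbound (N + k)%nat).
  set (n := S (N + k)) in *.
  assert (Hn : 0 <= INR n) by apply pos_INR.
  assert (Hp : forall z, 0 < z -> z ^ n = exp (INR n * ln z)).
  { intros z Hz; rewrite <- Rpower_pow by exact Hz; reflexivity. }
  rewrite Rabs_mult, !Hp by (try apply exp_pos; apply Rinv_0_lt_compat; lra).
  rewrite ln_exp, ln_Rinv, (Rabs_pos_eq (exp _)) by (try (left; apply exp_pos); lra).
  eapply Rle_trans; [apply Rmult_le_compat_r; [left; apply exp_pos|exact Hbound]|].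
  rewrite <- exp_plus, <- Rmult_plus_distr_l.
  match goal with |- exp ?s <= exp ?t => cut (s <= t) end.
  { intros [H|H]; [left; apply exp_increasing, H|rewrite H; lra]. }
  apply Rmult_le_compat_l; [exact Hn|].
  apply Rabs_lt_between in HN; unfold de in *; lra.
- apply (ex_series_incr_n (fun k => exp (- de) ^ k) (S N)), ex_series_geom.
  rewrite Rabs_pos_eq by (left; apply exp_pos); rewrite <- exp_0; apply exp_increasing; lra.
Qed.

(** * The Lambert function *)

Lemma sub_ln_incr (a b : R) : 1 <= a -> a < b -> a - ln a < b - ln b.
Proof.
intros Ha Hab; assert (H : ln b - ln a < b - a); [|lra].
rewrite <- ln_div by lra.
assert (Hba : 1 < b / a).
{ apply Rmult_lt_reg_r with a; [lra|]; unfold Rdiv; rewrite Rmult_assoc, Rinv_l; lra. }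
assert (He := exp_ineq1 (ln (b / a))).
assert (Hl : 0 < ln (b / a)) by (rewrite <- ln_1; apply ln_increasing; lra).
rewrite exp_ln in He by lra; specialize (He (Rgt_not_eq _ _ Hl)).
assert (b / a - 1 <= b - a); [|lra].
replace (b / a - 1) with ((b - a) * / a) by (field; lra).
assert (/ a <= 1) by (rewrite <- Rinv_1; apply Rinv_le_contravar; lra); nra.
Qed.

Lemma sub_ln_surj (q : R) : q <= 0 -> exists t, 1 <= t /\ t - ln t = 1 - q.
Proof.
intros Hq; destruct (Req_dec q 0) as [->|Hq0].
{ exists 1; rewrite ln_1; lra. }
destruct (IVT_interv (fun t => t - ln t - (1 - q)) 1 (2 * (1 - q))) as [t [Ht E]].
- intros t Ht; apply continuity_pt_filterlim.
  apply (ex_derive_continuous (K := R_AbsRing) (V := R_NormedModule) (fun t => t - ln t - (1 - q))).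
  auto_derive; lra.
- lra.
- rewrite ln_1; lra.
- assert (H2 : ln 2 < 1).
  { assert (H := exp_ineq1 (ln 2)); rewrite exp_ln in H by lra.
    assert (ln 2 <> 0) by (apply Rgt_not_eq; rewrite <- ln_1; apply ln_increasing; lra).
    specialize (H H0); lra. }
  rewrite ln_mult by lra.
  assert (H := exp_ineq1_le (ln (1 - q))); rewrite exp_ln in H by lra; lra.
- exists t; lra.
Qed.

Definition lambert_arg (p l : R) : R := - exp (p - 1) * l.

Lemma lambert_argE (p l : R) : 0 < l -> lambert_arg p l = - exp (p + ln l - 1).
Proof.
intros Hl; unfold lambert_arg; replace (p + ln l - 1) with ((p - 1) + ln l) by ring.
rewrite exp_plus, exp_ln by exact Hl; ring.
Qed.

Lemma exp_le (a b : R) : a <= b -> exp a <= exp b.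
Proof. intros [H|H]; [left; apply exp_increasing, H|rewrite H; lra]. Qed.

Lemma LambertWm1_spec (p l : R) : 0 < l ->
  is_LambertWm1 (lambert_arg p l) (LambertWm1 (lambert_arg p l)).
Proof.
intros Hl; apply (epsilon_spec (inhabits (RtoC 0)) (is_LambertWm1 (lambert_arg p l))); rewrite lambert_argE by exact Hl.
set (q := p + ln l); unfold is_LambertWm1; rewrite <- exp_Ropp.
destruct (Rle_lt_dec q 0) as [Hq|Hq].
- destruct (sub_ln_surj q Hq) as [t [Ht E]].
  exists (- t, 0); split.
  + unfold Cexp, Re, Im; simpl; rewrite cos_0, sin_0.
    replace (q - 1) with (- t + ln t) by lra; rewrite exp_plus, exp_ln by lra.
    apply injective_projections; simpl; ring.
  + left; unfold Re, Im; simpl; assert (He := exp_pos (q - 1)).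
    assert (exp (q - 1) <= exp (- (1))) by (apply exp_le; lra); lra.
- destruct (critical_q_surj q Hq) as [y [Hy E]].
  assert (Hs : 0 < sin y) by (apply sin_gt_0; lra); assert (Hd := div_sin_gt_1 y Hy).
  exists (- (y * (cos y / sin y)), - y); split.
  + unfold Cexp, Re, Im; simpl; rewrite cos_neg, sin_neg.
    replace (q - 1) with (- (y * (cos y / sin y)) + ln (y / sin y))
      by (rewrite <- E; unfold critical_q, one_sub_cot; ring).
    rewrite exp_plus, exp_ln by lra; set (e := exp _).
    apply injective_projections; simpl; [|field; lra].
    replace (- (e * (y / sin y))) with (- (e * (y * (sin y * sin y + cos y * cos y) / sin y))).
    * field; lra.
    * assert (Hsc := sin2_cos2 y); unfold Rsqr in Hsc; rewrite Hsc, Rmult_1_r; reflexivity.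
  + right; unfold Im; simpl; split; [|lra].
    assert (exp (- (1)) < exp (q - 1)) by (apply exp_increasing; lra); lra.
Qed.

Lemma LambertWm1_real (p l : R) : 0 < l -> p + ln l <= 0 ->
  exists t, 1 <= t /\ t - ln t = 1 - (p + ln l) /\ Re (LambertWm1 (lambert_arg p l)) = - t.
Proof.
intros Hl Hq; destruct (LambertWm1_spec p l Hl) as [E H].
set (w := LambertWm1 (lambert_arg p l)) in *.
rewrite lambert_argE in E, H by exact Hl; set (q := p + ln l) in *.
rewrite <- exp_Ropp in H; destruct H as [[H [Hi Hr]]|[H _]].
- exists (- Re w); split; [lra|split; [|ring]].
  assert (E1 : Re (w * Cexp w)%C = - exp (q - 1)) by (rewrite E; reflexivity).
  assert (Ei : snd w = 0) by exact Hi.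
  unfold Cexp, Re, Im in *; simpl in E1; rewrite Ei, cos_0, sin_0 in E1.
  assert (Ht : - fst w * exp (fst w) = exp (q - 1)) by lra.
  apply (f_equal ln) in Ht; rewrite ln_mult, !ln_exp in Ht by (try apply exp_pos; lra); lra.
- assert (exp (q - 1) <= exp (- (1))) by (apply exp_le; lra); lra.
Qed.

(** The imaginary part of [w e^w = x] gives [Re w = - y cot y] with
    [y = - Im w], and then its real part gives [critical_q y]. *)
Lemma LambertWm1_complex (p l : R) : 0 < l -> 0 < p + ln l ->
  exists y, 0 < y < PI /\ critical_q y = p + ln l /\
    Re (LambertWm1 (lambert_arg p l)) = one_sub_cot y - 1.
Proof.
intros Hl Hq; destruct (LambertWm1_spec p l Hl) as [E H].
set (w := LambertWm1 (lambert_arg p l)) in *.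
rewrite lambert_argE in E, H by exact Hl; set (q := p + ln l) in *.
rewrite <- exp_Ropp in H; destruct H as [[H _]|[_ Hi]].
- assert (exp (- (1)) < exp (q - 1)) by (apply exp_increasing; lra); lra.
- exists (- Im w); split; [lra|].
  set (y := - Im w); assert (Hs : 0 < sin y) by (apply sin_gt_0; unfold y; lra).
  assert (Hd := div_sin_gt_1 y ltac:(unfold y; lra)).
  assert (E1 : Re (w * Cexp w)%C = - exp (q - 1)) by (rewrite E; reflexivity).
  assert (E2 : Im (w * Cexp w)%C = 0) by (rewrite E; reflexivity).
  assert (Ei : snd w = - y) by (unfold y, Im; ring).
  unfold Cexp, Re, Im in E1, E2; simpl in E1, E2; rewrite Ei, cos_neg, sin_neg in E1, E2.
  change (fst w) with (Re w) in E1, E2; set (x := Re w) in *.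
  assert (He := exp_pos x).
  assert (Ex : x = - (y * (cos y / sin y))).
  { apply Rmult_eq_reg_r with (exp x * sin y); [|apply Rgt_not_eq; nra].
    replace (- (y * (cos y / sin y)) * (exp x * sin y)) with (- y * (exp x * cos y)) by (field; lra).
    lra. }
  split; [|unfold one_sub_cot; lra].
  assert (Eq : exp x * (y / sin y) = exp (q - 1)).
  { replace (exp x * (y / sin y)) with (exp x * (y * (sin y * sin y + cos y * cos y) / sin y)).
    - transitivity (- (- (y * (cos y / sin y)) * (exp x * cos y) - - y * (exp x * - sin y)));
        [field; lra|rewrite <- Ex; lra].
    - assert (Hsc := sin2_cos2 y); unfold Rsqr in Hsc; rewrite Hsc, Rmult_1_r; reflexivity. }
  apply (f_equal ln) in Eq; rewrite ln_mult, !ln_exp in Eq by (try apply exp_pos; lra).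
  unfold critical_q, one_sub_cot; lra.
Qed.

(** * The domain of convergence *)

Lemma is_eta0_iff (p y : R) : is_eta0 p y <-> 0 < y < PI /\ one_sub_cot y = p.
Proof. unfold is_eta0, one_sub_cot; split; intros [H1 H2]; split; lra. Qed.

Lemma one_sub_cot_lt_iff (a b : R) : 0 < a < PI -> 0 < b < PI ->
  (one_sub_cot a < one_sub_cot b <-> a < b).
Proof.
intros Ha Hb; split; intros H; [|apply one_sub_cot_incr; lra].
apply Rnot_le_lt; intros [H1|H1]; [assert (H2 := one_sub_cot_incr b a); lra|subst; lra].
Qed.

Lemma critical_q_lt_iff (a b : R) : 0 < a < PI -> 0 < b < PI ->
  (critical_q a < critical_q b <-> a < b).
Proof.
intros Ha Hb; split; intros H; [|apply critical_q_incr; lra].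
apply Rnot_le_lt; intros [H1|H1]; [assert (H2 := critical_q_incr b a); lra|subst; lra].
Qed.

Lemma exists_unique_eta0 (p : R) : 0 < p -> exists! y, is_eta0 p y.
Proof.
intros Hp; destruct (one_sub_cot_surj p Hp) as [y [Hy E]]; exists y; split.
- apply is_eta0_iff; auto.
- intros y' H; apply is_eta0_iff in H; destruct H as [Hy' E'].
  destruct (Rtotal_order y y') as [H|[H|H]]; [|exact H|].
  + apply one_sub_cot_lt_iff in H; lra.
  + apply one_sub_cot_lt_iff in H; lra.
Qed.

Lemma eta0_spec (p : R) : 0 < p -> 0 < eta0 p < PI /\ one_sub_cot (eta0 p) = p.
Proof.
intros Hp; apply is_eta0_iff, (epsilon_spec (inhabits 0) (is_eta0 p)).
destruct (exists_unique_eta0 p Hp) as [y [Hy _]]; exists y; exact Hy.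
Qed.

(** The bound in terms of [l = p + ln z], the only way in which [z] enters. *)
Definition l_bound (p : R) : R :=
  if Rle_dec p 0 then 1 - p else eta0 p / sin (eta0 p).

Lemma l_bound_pos (p : R) : 0 < l_bound p.
Proof.
unfold l_bound; destruct (Rle_dec p 0) as [Hp|Hp]; [lra|].
destruct (eta0_spec p) as [H _]; [lra|]; assert (H1 := div_sin_gt_1 _ H); lra.
Qed.

Lemma z_bound_lt_iff (p z : R) : 0 < z -> (z_bound p < z <-> l_bound p < p + ln z).
Proof.
intros Hz.
assert (E : z_bound p = exp (l_bound p - p)).
{ unfold z_bound, l_bound; destruct (Rle_dec p 0); simpl; f_equal; unfold Rdiv; ring. }
rewrite E; split; intros H.
- apply ln_increasing in H; [rewrite ln_exp in H; lra|apply exp_pos].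
- rewrite <- (exp_ln z) by exact Hz; apply exp_increasing; lra.
Qed.

(** For [p + ln l > 0] the Lambert condition reads [one_sub_cot y > p]; it
    always holds if [p <= 0], and is [y > eta0 p] if [p > 0].  For
    [p + ln l <= 0] the Lambert value is real and at most [- 1], so the condition
    fails if [p > 0]; if [p <= 0] it is [1 - p < l] because [t - ln t]
    increases. *)
Lemma lambert_condition_iff (p l : R) : 0 < l ->
  (p - 1 < Re (LambertWm1 (lambert_arg p l)) <-> l_bound p < l).
Proof.
intros Hl; assert (Hel := exp_ln l Hl).
assert (Hexp : forall x, 1 + x <= exp x) by apply exp_ineq1_le.
destruct (Rle_lt_dec (p + ln l) 0) as [Hq|Hq].
- destruct (LambertWm1_real p l Hl Hq) as [t [Ht [E ->]]].
  unfold l_bound; destruct (Rle_dec p 0) as [Hp|Hp].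
  + split; intros H.
    * assert (Hi := sub_ln_incr t (1 - p) Ht ltac:(lra)).
      rewrite <- Hel, <- (exp_ln (1 - p)) by lra; apply exp_increasing; lra.
    * apply ln_increasing in H; [|lra].
      assert (Hc : ~ 1 - p <= t); [|lra]; intros [Hc|Hc].
      -- assert (Hi := sub_ln_incr (1 - p) t ltac:(lra) Hc); lra.
      -- rewrite Hc in H; lra.
  + split; intros H; [lra|]; exfalso.
    destruct (eta0_spec p) as [He _]; [lra|]; assert (H1 := div_sin_gt_1 _ He).
    assert (exp (ln l) < 1) by (rewrite <- exp_0; apply exp_increasing; lra); lra.
- destruct (LambertWm1_complex p l Hl Hq) as [y [Hy [E ->]]].
  assert (Hpos := one_sub_cot_pos y Hy).
  unfold l_bound; destruct (Rle_dec p 0) as [Hp|Hp].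
  + split; intros _; [|lra].
    assert (He : exp (- p) < exp (ln l)) by (apply exp_increasing; lra).
    specialize (Hexp (- p)); lra.
  + destruct (eta0_spec p) as [He Ee]; [lra|]; set (e := eta0 p) in *.
    assert (Hde := div_sin_gt_1 e He).
    assert (Hce : critical_q e = p + ln (e / sin e)) by (unfold critical_q; lra).
    assert (H1 := one_sub_cot_lt_iff e y He Hy); assert (H2 := critical_q_lt_iff e y He Hy).
    split; intros H.
    * assert (Hey : critical_q e < critical_q y) by (apply H2, H1; lra).
      rewrite <- Hel, <- (exp_ln (e / sin e)) by lra; apply exp_increasing; lra.
    * apply ln_increasing in H; [|lra].
      assert (Hey : one_sub_cot e < one_sub_cot y) by (apply H1, H2; lra); lra.
Qed.

Lemma ex_series_beyond_bound (p l : R) : 0 < l -> l_bound p < l ->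
  ex_series (fun n => coef n (p + ln l) * (/ l) ^ n).
Proof.
intros Hl H; assert (Hc := proj2 (lambert_condition_iff p l Hl) H).
destruct (Rle_lt_dec (p + ln l) 0) as [Hq|Hq].
- destruct (LambertWm1_real p l Hl Hq) as [t [Ht [_ E]]]; rewrite E in Hc.
  unfold l_bound in H; destruct (Rle_dec p 0) as [Hp|Hp]; [|lra].
  apply ex_series_q_nonpos; assumption.
- destruct (LambertWm1_complex p l Hl Hq) as [y [Hy [E E2]]]; rewrite E2 in Hc.
  rewrite <- E; apply ex_series_q_pos; [exact Hy|].
  assert (Hd := div_sin_gt_1 y Hy); unfold critical_q in E.
  rewrite <- (exp_ln l), <- (exp_ln (y / sin y)) by lra; apply exp_increasing; lra.
Qed.

(** The point [a] separates [V] from the other, negative critical point. *)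
Lemma real_critical_point (q a : R) : q < 0 -> 0 <= a -> exp a < a + 1 - q ->
  exists V, a < V /\ exp V = V + 1 - q.
Proof.
intros Hq Ha H.
destruct (IVT_interv (fun V => exp V - (V + 1 - q)) a (a + 4 * (1 - q))) as [V [HV E]].
- intros V _; apply continuity_pt_filterlim.
  apply (ex_derive_continuous (K := R_AbsRing) (V := R_NormedModule) (fun V => exp V - (V + 1 - q))).
  auto_derive; trivial.
- lra.
- lra.
- (* [exp T >= (1 + T / 2) ^ 2] and [T / 4 >= 1 - q]. *)
  set (T := a + 4 * (1 - q)).
  assert (He := exp_ineq1_le (T / 2)).
  assert (E2 : exp T = exp (T / 2) * exp (T / 2)) by (rewrite <- exp_plus; f_equal; field).
  assert (HT : 4 * (1 - q) <= T) by (unfold T; lra).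
  assert ((1 + T / 2) * (1 + T / 2) <= exp (T / 2) * exp (T / 2)) by (apply Rmult_le_compat; lra).
  rewrite E2; nra.
- exists V; split; [|lra]; destruct (Req_dec V a) as [->|]; lra.
Qed.

(** At [p + ln l = 0] all terms vanish, whatever [l] is. *)
Lemma not_ex_series_below_bound (p l : R) : 0 < l -> l < l_bound p -> p + ln l <> 0 ->
  ~ ex_series (fun n => coef n (p + ln l) * (/ l) ^ n).
Proof.
intros Hl H Hq0; assert (Hel := exp_ln l Hl).
destruct (Rle_lt_dec (p + ln l) 0) as [Hq|Hq].
- assert (HV : exists V, 0 < V /\ exp V = V + 1 - (p + ln l) /\ l < exp V).
  { destruct (Rle_lt_dec l 1) as [Hl1|Hl1].
    - destruct (real_critical_point (p + ln l) 0) as [V [HV E]]; [lra|lra|rewrite exp_0; lra|].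
      exists V; assert (He := exp_increasing 0 V HV); rewrite exp_0 in He; lra.
    - assert (Hln : 0 < ln l) by (rewrite <- ln_1; apply ln_increasing; lra).
      unfold l_bound in H; destruct (Rle_dec p 0) as [Hp|Hp]; [|lra].
      destruct (real_critical_point (p + ln l) (ln l)) as [V [HV E]]; [lra|lra|lra|].
      exists V; assert (He := exp_increasing _ _ HV); lra. }
  destruct HV as [V [HV [E HlV]]]; apply (not_ex_series_q_neg _ V); lra.
- destruct (LambertWm1_complex p l Hl Hq) as [y [Hy [E E2]]].
  assert (Hc : ~ p < one_sub_cot y).
  { intros Hc; assert (p - 1 < Re (LambertWm1 (lambert_arg p l))) by lra.
    apply lambert_condition_iff in H0; lra. }
  rewrite <- E; apply not_ex_series_q_pos; [exact Hy|]; split; [exact Hl|].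
  assert (Hd := div_sin_gt_1 y Hy); unfold critical_q in E.
  assert (Hne : one_sub_cot y <> p).
  { intros Ep; assert (Hpos := one_sub_cot_pos y Hy).
    unfold l_bound in H; destruct (Rle_dec p 0) as [Hp|Hp]; [lra|].
    destruct (eta0_spec p) as [He Ee]; [lra|].
    assert (Ey : y = eta0 p).
    { destruct (Rtotal_order y (eta0 p)) as [Hlt|[Heq|Hlt]]; [|exact Heq|];
        apply one_sub_cot_lt_iff in Hlt; lra. }
    rewrite <- Ey in H.
    assert (ln l = ln (y / sin y)) by lra.
    assert (l = y / sin y) by (rewrite <- Hel, <- (exp_ln (y / sin y)) by lra; f_equal; assumption).
    lra. }
  rewrite <- (exp_ln (y / sin y)), <- Hel by lra; apply exp_increasing; lra.
Qed.

Lemma convergence_set_iff (p z : R) :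
  convergence_set p z <-> 0 < z /\ 0 < p + ln z /\
    ex_series (fun n => coef n (p + ln (p + ln z)) * (/ (p + ln z)) ^ n).
Proof.
unfold convergence_set; split; intros [Hz [Hl H]]; split; [exact Hz|split; [exact Hl|]| |split; [exact Hl|]]; trivial.
- apply ex_series_incr_1; eapply ex_series_ext; [|exact H].
  intros n; apply series_term_coef, Hl.
- apply ex_series_incr_1 in H; eapply ex_series_ext; [|exact H].
  intros n; symmetry; apply series_term_coef, Hl.
Qed.

(** If [z] is interior and at most the bound, the series converges at all points
    slightly to the left of [z].  By [not_ex_series_below_bound] each of them
    satisfies [p + ln (p + ln z) = 0], which has one solution only. *)
Lemma convergence_domain_iff (p z : R) : 0 < z ->
  (convergence_domain p z <-> z_bound p < z).
Proof.
intros Hz; split.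
- intros [e He]; apply Rnot_le_lt; intros Hzb.
  set (d := Rmin e z); assert (Hd : 0 < d) by (apply Rmin_pos; [apply cond_pos|exact Hz]).
  assert (Hde : d <= e) by apply Rmin_l; assert (Hdz : d <= z) by apply Rmin_r.
  assert (H : forall k, 0 < k < 1 -> 0 < p + ln (z - k * d) /\ p + ln (p + ln (z - k * d)) = 0).
  { intros k Hk; assert (Hkd : 0 < k * d < d) by nra.
    assert (Hb : ball z e (z - k * d)).
    { apply Rabs_def1; unfold minus, plus, opp; simpl; lra. }
    apply He, convergence_set_iff in Hb; destruct Hb as [Hz' [Hl' Hs]]; split; [exact Hl'|].
    destruct (Req_dec (p + ln (p + ln (z - k * d))) 0) as [E|Hne]; [exact E|exfalso].
    revert Hs; apply not_ex_series_below_bound; [exact Hl'| |exact Hne].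
    assert (Hlt : z - k * d < z_bound p) by lra.
    apply Rnot_le_lt; intros [Hc|Hc]; [apply z_bound_lt_iff in Hc; lra|].
    assert (Hi : ln (z - k * d) < ln (z_bound p)) by (apply ln_increasing; lra).
    assert (Hzb0 : 0 < z_bound p) by lra.
    assert (l_bound p < p + ln (z_bound p)) by lra.
    apply z_bound_lt_iff in H; lra. }
  destruct (H (1 / 2) ltac:(lra)) as [H1 E1]; destruct (H (1 / 3) ltac:(lra)) as [H2 E2].
  assert (E : p + ln (z - 1 / 2 * d) = p + ln (z - 1 / 3 * d)) by (apply ln_inv; lra).
  assert (E' : z - 1 / 2 * d = z - 1 / 3 * d) by (apply ln_inv; lra); lra.
- intros H; assert (Hzb : 0 < z_bound p) by (unfold z_bound; destruct (Rle_dec p 0); apply exp_pos).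
  assert (He : 0 < z - z_bound p) by lra.
  exists (mkposreal _ He); intros z' Hz'; apply Rabs_def2 in Hz'; simpl in Hz'.
  unfold minus, plus, opp in Hz'; simpl in Hz'.
  assert (Hz'b : z_bound p < z') by lra; assert (Hz'0 : 0 < z') by lra.
  apply z_bound_lt_iff in Hz'b; [|exact Hz'0].
  assert (Hlp := l_bound_pos p).
  apply convergence_set_iff; split; [exact Hz'0|split; [lra|]].
  apply ex_series_beyond_bound; lra.
Qed.

Lemma exp_opp_lt_iff (p z : R) : 0 < z -> (exp (- p) < z <-> 0 < p + ln z).
Proof.
intros Hz; split; intros H.
- apply ln_increasing in H; [rewrite ln_exp in H; lra|apply exp_pos].
- rewrite <- (exp_ln z) by exact Hz; apply exp_increasing; lra.
Qed.

Theorem theorem23 (p : R) :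
  (p > 0 -> exists! eta : R, is_eta0 p eta) /\
  forall z : R, z > 0 ->
    (convergence_domain p z <->
       (Re (LambertWm1 (- exp (p - 1) * (p + ln z))) > p - 1 /\ z > exp (- p)))
    /\
    ((Re (LambertWm1 (- exp (p - 1) * (p + ln z))) > p - 1 /\ z > exp (- p)) <->
       z > z_bound p).
Proof.
split; [apply exists_unique_eta0|].
intros z Hz.
assert (H : (Re (LambertWm1 (- exp (p - 1) * (p + ln z))) > p - 1 /\ z > exp (- p)) <->
       z > z_bound p).
{ unfold Rgt; rewrite (z_bound_lt_iff p z Hz), (exp_opp_lt_iff p z Hz).
  split.
  - intros [H1 H2]; apply lambert_condition_iff in H1; assumption.
  - intros H1; assert (Hlp := l_bound_pos p); split; [|lra].
    apply lambert_condition_iff; [lra|exact H1]. }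
split; [|exact H].
rewrite H; apply convergence_domain_iff, Hz.
Qed.
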